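(* Let $F$ be a field, $1\le l<m$ integers, $k=\binom ml$ and $1\le K\le k$. The maximal Krull dimension of a component of a linear section $G(l,m)\cap\Lambda$, where $\Lambda$ ranges over all linear subspaces of the Plücker space $\mathbf P^{k-1}$ of projective dimension $K-1$, is equal to the maximal Krull dimension of a component of a linear section $G(l,m)\cap\Lambda$, where $\Lambda$ ranges only over those linear subspaces of $\mathbf P^{k-1}$ of projective dimension $K-1$ that are spanned by a Schubert union.
   Context: $V$ is an $m$-dimensional $F$-vector space with basis $e_1,\dots,e_m$, and $A_i=\mathrm{Span}(e_1,\dots,e_i)$. $G(l,m)$ is the Grassmann variety of $l$-dimensional subspaces of $V$, embedded in the Plücker space $\mathbf P^{k-1}=\mathbf P(\wedge^lV)$ by Plücker coordinates. For $\alpha=(a_1,\dots,a_l)$ with $1\le a_1<\dots<a_l\le m$ the Schubert cycle is $S_\alpha=\{W\in G(l,m):\dim(W\cap A_{a_i})\ge i,\ i=1,\dots,l\}$, and a Schubert union is a finite union of Schubert cycles with respect to this fixed flag. If $F$ is not algebraically closed, the linear subspaces $\Lambda$ are those defined over $F$. *)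

(* Defs.v *)
From HB Require Import structures.
From mathcomp Require Import all_boot all_order all_algebra.
From mathcomp Require Import mpoly.

Set Implicit Arguments.
Unset Strict Implicit.
Unset Printing Implicit Defensive.

Import GRing.Theory.
Local Open Scope ring_scope.

(* ------------------------------------------------------------------------ *)
(* Zariski topology of P^(n-1) over a field E.                              *)
(* A set of projective points is given by its homogeneous coordinate        *)
(* vectors, so it is a predicate on nonzero vectors of E^n.  The closed     *)
(* sets below are the cones (minus 0) over the projective closed sets, i.e. *)
(* their preimages under E^n \ {0} -> P^(n-1); since this quotient topology *)
(* is the one of P^(n-1), irreducible subsets, irreducible components and   *)
(* chains of closed irreducible subsets correspond to those of P^(n-1).     *)
(* ------------------------------------------------------------------------ *)

Definition pset (E : fieldType) (n : nat) := 'rV[E]_n -> Prop.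

Section Zariski.
Variables (E : fieldType) (n : nat).
Implicit Types (X C T Z : pset E n).

Definition psub X T := forall v, X v -> T v.
Definition pproper X T := psub X T /\ ~ psub T X.

Definition zclosed T :=
  exists P : {mpoly E[n]} -> Prop,
    (forall p, P p -> exists d : nat, p \is d.-homog) /\
    (forall v, T v <-> v != 0 /\ (forall p, P p -> p.@[v ord0] = 0)).

(* closed in the subspace topology of X *)
Definition closed_in X Z :=
  exists2 T, zclosed T & forall v, Z v <-> X v /\ T v.

Definition irreducible Z :=
  (exists v, Z v) /\
  (forall T1 T2, zclosed T1 -> zclosed T2 ->
     (forall v, Z v -> T1 v \/ T2 v) -> psub Z T1 \/ psub Z T2).

Definition component X C :=
  [/\ psub C X, irreducible C
    & forall Z, irreducible Z -> psub Z X -> psub C Z -> psub Z C].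

Definition irred_chain C (d : nat) :=
  exists Z : nat -> pset E n,
    (forall i, (i <= d)%N -> irreducible (Z i) /\ closed_in C (Z i)) /\
    (forall i, (i < d)%N -> pproper (Z i) (Z i.+1)).

Definition krull_dim C (d : nat) :=
  irred_chain C d /\ (forall r, irred_chain C r -> (r <= d)%N).

End Zariski.

Definition is_max (P : nat -> Prop) (d : nat) :=
  P d /\ (forall r, P r -> (r <= d)%N).

(* ------------------------------------------------------------------------ *)
(* Multi-indices a_1 < ... < a_l in {1..m}; they are stored 0-based, so the *)
(* 1-based entry a_(i+1) is (tnth a i).+1.                                  *)
(* ------------------------------------------------------------------------ *)

Definition midx (l m : nat) :=
  {a : l.-tuple 'I_m | sorted ltn [seq val x | x <- a]}.

Lemma card_midx (l m : nat) : #|{: midx l m}| = 'C(m, l).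
Proof. by rewrite card_sig -card_ltn_sorted_tuples cardsE. Qed.

(* enumeration of the coordinates of the Pluecker space *)
Definition coord_idx (l m : nat) (i : 'I_('C(m, l))) : midx l m :=
  enum_val (cast_ord (esym (card_midx l m)) i).

Section Grassmann.
Variables (E : fieldType) (l m : nat).

(* An l-dimensional subspace W of V = E^m is given as the row space of a    *)
(* row-free l x m matrix; its Pluecker coordinates are the maximal minors.  *)
Definition plucker (W : 'M[E]_(l, m)) : 'rV[E]_('C(m, l)) :=
  \row_i \det (colsub (tnth (val (coord_idx i))) W).

(* v is a vector of homogeneous coordinates of the point [W]; changing the  *)
(* basis of W rescales plucker W.                                           *)
Definition represents (v : 'rV[E]_('C(m, l))) (W : 'M[E]_(l, m)) :=
  row_free W /\ (exists2 c : E, c != 0 & v = c *: plucker W).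

Definition grass : pset E 'C(m, l) :=
  fun v => exists W, represents v W.

(* pid_mx j has row space A_j = Span(e_1, ..., e_j) *)
Definition flag (j : nat) : 'M[E]_m := pid_mx j.

Definition schubert (a : midx l m) : pset E 'C(m, l) :=
  fun v => exists2 W, represents v W
    & forall i : 'I_l, (i.+1 <= \rank (W :&: flag (tnth (val a) i).+1)%MS)%N.

Definition schubert_union (A : {set midx l m}) : pset E 'C(m, l) :=
  fun v => exists2 a, a \in A & schubert a v.

(* the smallest linear subspace containing X is the row space of L *)
Definition spanned_by (n : nat) (L : 'M[E]_n) (X : pset E n) :=
  (forall v, X v -> (v <= L)%MS) /\
  (forall L' : 'M[E]_n, (forall v, X v -> (v <= L')%MS) -> (L <= L')%MS).

End Grassmann.

(* For an extension iota : F -> E, linear subspaces defined over F are      *)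
(* given by matrices L over F; their E-points form the row space of         *)
(* map_mx iota L, and projective dimension is \rank L - 1.                  *)
Section LinearSection.
Variables (F E : fieldType) (iota : {rmorphism F -> E}) (l m : nat).

Definition lin_section (L : 'M[F]_('C(m, l))) : pset E 'C(m, l) :=
  fun v => grass v /\ (v <= map_mx iota L)%MS.

Definition has_component_dim (L : 'M[F]_('C(m, l))) (d : nat) :=
  exists2 C, component (lin_section L) C & krull_dim C d.

Definition schubert_spanned (L : 'M[F]_('C(m, l))) :=
  exists A : {set midx l m},
    spanned_by (map_mx iota L) (schubert_union (E := E) A).

End LinearSection.

(* Main.v *)
(* The dimension of a linear section v M = 0 of the Grassmannian is bounded by the growth in N
   of its Hilbert function.  Dually, this function is the dimension of the space of tensors of
   degree N + 1 in the span of the powers of the points of the cone over the Grassmannian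
   which are annihilated by the columns of M in the first slot.
   - If the section contains a chain of r + 1 irreducible closed sets, its Hilbert function grows
     at least like N^r: contraction with a form separating two consecutive sets gives Pascal's
     recursion.
   - Ranks of polynomial matrices are semicontinuous, so the Hilbert function does not decrease
     when the linear space is degenerated.  A torus limit followed by limits of elementary shears
     (combinatorial shifts) replaces the linear space by the coordinate space of a down-set A of
     indices, of at most the same dimension.  This replaces Borel's fixed point theorem.
   - For a down-set A the Hilbert function is O(N^r), r the maximal rank of an index of A: slice
     the tensors at an index of maximal sum.
   Coordinate spaces of down-sets are spanned by Schubert unions, and the Schubert variety of b in A
   is irreducible and carries the chain of length rk b obtained by lowering entries one by one. *)

Require Import Defs.
From HB Require Import structures.
From mathcomp Require Import all_boot all_order all_fingroup all_algebra.
From mathcomp Require Import mpoly zify.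
From Stdlib Require Import Classical ClassicalEpsilon.

Set Implicit Arguments.
Unset Strict Implicit.
Unset Printing Implicit Defensive.

Import GRing.Theory.
Local Open Scope ring_scope.

(** * Spans and kernels of operators *)

Section Cspan.
Variables (E : fieldType) (vT : vectType E).
Implicit Types (X : vT -> Prop) (U : {vspace vT}).

(** [X] is an arbitrary predicate, so its span is built by adjoining elements of [X] one at a time
    until none is missing; the codimension drops at each step. The invariant [P] says that [U] lies
    in every subspace containing [X]. *)
Lemma cspan_exists X : exists U : {vspace vT},
  (forall x, X x -> x \in U) /\
  (forall U', (forall x, X x -> x \in U') -> (U <= U')%VS).
Proof.
pose P U := forall U', (forall x, X x -> x \in U') -> (U <= U')%VS.
have P0 : P 0%VS by move=> U' _; exact: sub0v.
suff H n : forall U, P U -> (\dim {:vT} - \dim U <= n)%N -> exists U,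
    (forall x, X x -> x \in U) /\ P U.
  exact: (H _ 0%VS P0 (leqnn _)).
elim: n => [|n IH] U PU hU; case: (classic (forall x, X x -> x \in U)) => HX.
- by exists U.
- case: HX => x _; have -> : U = fullv.
    by apply/eqP; rewrite eqEdim subvf; move: hU; rewrite leqn0 subn_eq0.
  exact: memvf.
- by exists U.
have [x Hx] := not_all_ex_not _ _ HX.
have [Xx xU] := imply_to_and _ _ Hx.
apply: (IH (U + <[x]>)%VS).
  move=> U' HU'; rewrite subv_add PU //=; apply: HU'; exact: Xx.
have lt : (\dim U < \dim (U + <[x]>))%N.
  rewrite ltn_neqAle dimvS ?addvSl // andbT; apply/negP => /eqP e.
  apply: xU; have /eqP -> : U == (U + <[x]>)%VS by rewrite eqEdim addvSl e /=.
  by apply: (subvP (addvSr U <[x]>)); exact: memv_line.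
have := dimvS (subvf (U + <[x]>)%VS); lia.
Qed.

Definition cspan X : {vspace vT} :=
  proj1_sig (constructive_indefinite_description _ (cspan_exists X)).

Lemma mem_cspan X x : X x -> x \in cspan X.
Proof. by rewrite /cspan; case: constructive_indefinite_description => U [? ?] /=; auto. Qed.

Lemma cspan_sub X U : (forall x, X x -> x \in U) -> (cspan X <= U)%VS.
Proof. by rewrite /cspan; case: constructive_indefinite_description => V [? ?] /=; auto. Qed.

Lemma cspan_ker (wT : vectType E) (f : 'Hom(vT, wT)) X x :
  (forall y, X y -> f y = 0) -> x \in cspan X -> f x = 0.
Proof.
move=> Xf xX; apply/eqP; rewrite -memv_ker; move: x xX; apply/subvP.
by apply: cspan_sub => y Xy; rewrite memv_ker Xf.
Qed.

End Cspan.

Section KernelOp.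
Variables (E : fieldType) (I J : finType).

(** Operators are given by their matrix entries, so that a family with polynomial entries can be
    specialised entrywise. *)
Definition kop_fun (A : J -> I -> E) (x : {ffun I -> E^o}) : {ffun J -> E^o} :=
  [ffun j => \sum_i A j i * x i].

Lemma kop_linear A : linear (kop_fun A).
Proof.
move=> c x y; apply/ffunP => j; rewrite !ffunE scaler_sumr -big_split /=.
apply: eq_bigr => i _; rewrite !ffunE mulrDr; congr (_ + _).
by rewrite /GRing.scale /= mulrCA.
Qed.

HB.instance Definition _ A := GRing.isLinear.Build E _ _ _ (kop_fun A) (kop_linear A).

Definition kop A : 'Hom({ffun I -> E^o}, {ffun J -> E^o}) := linfun (kop_fun A).

Lemma kopE A x j : kop A x j = \sum_i A j i * x i.
Proof. by rewrite lfunE /= ffunE. Qed.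

Lemma eq_kop (A B : J -> I -> E) : A =2 B -> kop A = kop B.
Proof.
move=> AB; apply/lfunP => x; apply/ffunP => j; rewrite !kopE.
by apply: eq_bigr => i _; rewrite AB.
Qed.

End KernelOp.

Section FfunCoord.
Variables (E : fieldType) (I : finType).

Lemma ffun_sum_delta (x : {ffun I -> E^o}) :
  x = \sum_i x i *: ([ffun j => (i == j)%:R] : {ffun I -> E^o}).
Proof.
apply/ffunP => j; rewrite sum_ffunE (bigD1 j) //= big1 => [|i /negPf ij].
  by rewrite !ffunE eqxx addr0 /GRing.scale /= mulr1.
by rewrite !ffunE ij scaler0.
Qed.

(** The complementary projection [p] kills [U] but not [x]; the functional is a coordinate [t] of
    [p] at which [p x] is nonzero. *)
Lemma separating_functional (U : {vspace {ffun I -> E^o}}) (x : {ffun I -> E^o}) :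
  x \notin U -> exists phi : I -> E,
    (forall y, y \in U -> \sum_i phi i * y i = 0) /\ \sum_i phi i * x i != 0.
Proof.
move=> xU; pose p := (\1 - projv U)%VF.
have pE y : p y = y - projv U y by rewrite /p add_lfunE id_lfunE opp_lfunE.
have pS y t : p y t = \sum_i p [ffun j => (i == j)%:R] t * y i.
  rewrite {1}[y]ffun_sum_delta linear_sum sum_ffunE; apply: eq_bigr => i _.
  by rewrite linearZ ffunE /GRing.scale /= mulrC.
have [/eqP px0|] := boolP (p x == 0).
  by case/negP: xU; move/eqP: px0; rewrite pE subr_eq0 => /eqP ->; exact: memv_proj.
move=> px; have /existsP[t pxt] : [exists t, p x t != 0].
  apply: contraNT px; rewrite negb_exists => /forallP px0.
  by apply/eqP/ffunP => t; rewrite ffunE; apply/eqP/negPn.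
exists (fun i => p [ffun j => (i == j)%:R] t); split; last by rewrite -pS.
by move=> y yU; rewrite -pS pE projv_id // subrr ffunE.
Qed.

End FfunCoord.

(** * Semicontinuity of ranks and kernels in a polynomial family of operators *)

Section Semicontinuity.
Variables (E : closedFieldType).

Lemma nonroot_nz (p : {poly E}) : p.[0] != 0 -> exists2 c, c != 0 & p.[c] != 0.
Proof.
move=> p0; have /closed_nonrootP [c] : p * 'X != 0.
  by rewrite mulf_neq0 ?polyX_eq0 //; apply: contraNneq p0 => ->; rewrite horner0.
by rewrite rootM rootX negb_or => /andP[]; exists c.
Qed.

Lemma det_horner n (M : 'M[{poly E}]_n) c :
  (\det M).[c] = \det (\matrix_(i, j) (M i j).[c]).
Proof. by rewrite -[LHS]/(horner_eval c _) -det_map_mx; congr (\det _); apply/matrixP => i j; rewrite !mxE. Qed.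

(** Lift a basis [e] of the image at 0 to vectors [x i] of [D]. The [e]-coordinates of their images
    at [c] form a matrix polynomial in [c] that is the identity at 0. Its determinant is thus
    nonzero at some [c != 0], and there the images remain independent. *)
Lemma kop_img_semicont (I J : finType) (A : J -> I -> {poly E})
    (D : {vspace {ffun I -> E^o}}) : exists2 c, c != 0 &
  (\dim (kop (fun j i => (A j i).[0%R]) @: D) <=
   \dim (kop (fun j i => (A j i).[c]) @: D))%N.
Proof.
pose f c := kop (fun j i => (A j i).[c]).
set r := \dim _; pose e := vbasis (f 0 @: D).
have /fin_all_exists2 [x xD xe] : forall i : 'I_r,
    exists2 x, x \in D & e`_i = f 0 x :> {ffun J -> E^o}.
  by move=> i; apply/memv_imgP/vbasis_mem/mem_nth; rewrite size_tuple.
pose del (s : J) : {ffun J -> E^o} := [ffun j => (s == j)%:R].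
pose M : 'M[{poly E}]_r :=
  \matrix_(i, j) \sum_s (\sum_u A s u * (x i u)%:P) * (coord e j (del s))%:P.
have ME c i j : (M i j).[c] = coord e j (f c (x i)).
  rewrite mxE horner_sum [f c (x i)]ffun_sum_delta linear_sum.
  apply: eq_bigr => s _; rewrite linearZ /= hornerM hornerC kopE horner_sum.
  by congr (_ * _); apply: eq_bigr => u _; rewrite hornerM hornerC.
have [c c0 Mc] : exists2 c, c != 0 & (\det M).[c] != 0.
  apply: nonroot_nz; rewrite det_horner (_ : (\matrix_(i, j) _) = 1%:M) ?det1 ?oner_eq0 //.
  apply/matrixP => i j; rewrite [LHS]mxE [RHS]mxE ME -xe.
  by rewrite coord_free ?(basis_free (vbasisP _)).
exists c => //.
pose X := [tuple f c (x i) | i < r].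
have fX : free X.
  apply/freeP => a a0 i.
  have Mu : (\matrix_(i, j) (M i j).[c]) \in unitmx.
    by rewrite unitmxE unitfE -det_horner.
  have : (\row_i a i) *m (\matrix_(i, j) (M i j).[c]) = 0.
    apply/rowP => j; rewrite !mxE.
    transitivity (coord e j (\sum_(i < r) a i *: X`_i)); last by rewrite a0 linear0.
    rewrite linear_sum; apply: eq_bigr => i' _.
    have -> : X`_i' = f c (x i') by rewrite -tnth_nth tnth_mktuple.
    by rewrite linearZ /= [X in X * _]mxE [X in _ * X]mxE ME.
  move/(congr1 (mulmx^~ (invmx (\matrix_(i, j) (M i j).[c])))).
  by rewrite mulmxK // mul0mx => /rowP /(_ i); rewrite !mxE.
have := fX; rewrite /free size_tuple => /eqP <-.
apply/dimvS/span_subvP => _ /mapP[i _ ->].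
exact: memv_img.
Qed.

(** Rank-nullity on [D]: the image at 0 is no larger than the image at some nonzero [c]. *)
Lemma kop_ker_semicont (I J : finType) (A : J -> I -> {poly E})
    (D : {vspace {ffun I -> E^o}}) b :
    (forall c, c != 0 ->
      (b <= \dim (D :&: lker (kop (fun j i => (A j i).[c]))))%N) ->
  (b <= \dim (D :&: lker (kop (fun j i => (A j i).[0%R]))))%N.
Proof.
have [c c0 le] := kop_img_semicont A D => /(_ c c0) hb.
rewrite -(leq_add2r (\dim (kop (fun j i => (A j i).[0%R]) @: D))) limg_ker_dim.
by rewrite -(limg_ker_dim (kop (fun j i => (A j i).[c])) D) leq_add.
Qed.

End Semicontinuity.

(** * Tensors and forms *)

Section Tensors.
Variables (E : fieldType) (k : nat).

Definition tens N := {ffun N.-tuple 'I_k -> E^o}.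

Definition tpow N (v : 'rV[E]_k) : tens N := [ffun t : N.-tuple 'I_k => \prod_(i <- t) v 0 i].

Lemma sum_tuple_cons (R : nmodType) N (F : N.+1.-tuple 'I_k -> R) :
  \sum_u F u = \sum_a \sum_(t : N.-tuple 'I_k) F (cons_tuple a t).
Proof.
rewrite pair_big /= (reindex (fun p : 'I_k * N.-tuple 'I_k => cons_tuple p.1 p.2)) //=.
exists (fun u => (thead u, behead_tuple u)) => [[a t] _ | u _] /=.
  by congr (_, _); apply: val_inj.
by rewrite [RHS]tuple_eta; apply: val_inj.
Qed.

Definition tact (G : 'M[E]_k) N : 'Hom(tens N, tens N) :=
  kop (fun t s : N.-tuple 'I_k => \prod_(p <- zip s t) G p.1 p.2).

Lemma tact_tpow G N v : tact G N (tpow N v) = tpow N (v *m G).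
Proof.
apply/ffunP => t; rewrite kopE ffunE.
elim: N t => [|N IH] t.
  rewrite (tuple0 t) big_nil (bigD1 [tuple]) //= [X in _ + X]big1 => [|u]; last by rewrite (tuple0 u).
  by rewrite ffunE !big_nil mulr1 addr0.
case/tupleP: t => j t; rewrite sum_tuple_cons big_cons -IH mxE mulr_suml.
apply: eq_bigr => a _; rewrite mulr_sumr; apply: eq_bigr => s _.
by rewrite !ffunE /= !big_cons /= mulrACA; congr (_ * _); rewrite mulrC.
Qed.

Definition tslice (b : 'I_k) N : 'Hom(tens N.+1, tens N) :=
  kop (fun (t : N.-tuple 'I_k) (u : N.+1.-tuple 'I_k) => (u == cons_tuple b t)%:R).

Lemma tsliceE b N (x : tens N.+1) t : tslice b N x t = x (cons_tuple b t).
Proof.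
rewrite kopE (bigD1 (cons_tuple b t)) //= eqxx mul1r big1 ?addr0 // => u /negPf ->.
by rewrite mul0r.
Qed.

Lemma tslice_tpow b N v : tslice b N (tpow N.+1 v) = v 0 b *: tpow N v.
Proof. by apply/ffunP => t; rewrite tsliceE !ffunE big_cons. Qed.

(** Coefficients of the contraction of the first slot with the columns of [M], over any ring so that
    [M] may have polynomial entries. *)
Definition ctr_coef (R : pzRingType) q (M : 'M[R]_(k, q)) N (ct : 'I_q * N.-tuple 'I_k)
    (u : N.+1.-tuple 'I_k) : R :=
  if behead_tuple u == ct.2 then M (thead u) ct.1 else 0.

Definition tctr q (M : 'M[E]_(k, q)) N := kop (ctr_coef M (N := N)).

Lemma tctrE q (M : 'M[E]_(k, q)) N (x : tens N.+1) c t :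
  tctr M N x (c, t) = \sum_a M a c * x (cons_tuple a t).
Proof.
rewrite kopE sum_tuple_cons; apply: eq_bigr => a _.
have bE (s : N.-tuple 'I_k) : ctr_coef M (c, t) (cons_tuple a s) = if s == t then M a c else 0.
  by rewrite /ctr_coef -!val_eqE.
rewrite (bigD1 t) //= bE eqxx big1 ?addr0 // => s /negPf st.
by rewrite bE st mul0r.
Qed.

Lemma tctr_eq0P q (M : 'M[E]_(k, q)) N (x : tens N.+1) :
  reflect (forall c t, \sum_a M a c * x (cons_tuple a t) = 0) (x \in lker (tctr M N)).
Proof.
rewrite memv_ker; apply: (iffP eqP) => [x0 c t|x0]; first by rewrite -tctrE x0 ffunE.
by apply/ffunP => -[c t]; rewrite tctrE x0 ffunE.
Qed.

Definition form_at d (phi : d.-tuple 'I_k -> E) (v : 'rV[E]_k) : E :=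
  \sum_u phi u * tpow d v u.

Definition tform d (phi : d.-tuple 'I_k -> E) N : 'Hom(tens (d + N), tens N) :=
  kop (fun (t : N.-tuple 'I_k) (w : (d + N).-tuple 'I_k) =>
     \sum_u phi u * (w == cat_tuple u t)%:R).

Lemma tform_tpow d (phi : d.-tuple 'I_k -> E) N v :
  tform phi N (tpow (d + N) v) = form_at phi v *: tpow N v.
Proof.
apply/ffunP => t; rewrite kopE [RHS]ffunE.
under eq_bigr do rewrite mulr_suml.
rewrite exchange_big /= /form_at /GRing.scale /= mulr_suml; apply: eq_bigr => u _.
rewrite (bigD1 (cat_tuple u t)) //= eqxx mulr1 big1 ?addr0 => [|w /negPf ->].
  by rewrite !ffunE /= big_cat mulrA.
by rewrite mulr0 mul0r.
Qed.

Lemma mpoly_of_form d (phi : d.-tuple 'I_k -> E) :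
  exists2 p : {mpoly E[k]}, p \is d.-homog & forall v : 'rV_k, p.@[v ord0] = form_at phi v.
Proof.
exists (\sum_u phi u *: \prod_(i <- tval u) 'X_i) => [|v].
  apply: rpred_sum => u _; apply: rpredZ; rewrite -{2}(size_tuple u).
  elim: (tval u) => [|i s IH] /=; first by rewrite big_nil dhomog1.
  rewrite big_cons -[(size s).+1]/(1 + size s)%N; apply: dhomogM IH.
  by rewrite dhomogX /= mdeg1.
rewrite raddf_sum; apply: eq_bigr => u _; rewrite ffunE /= mevalZ; congr (_ * _).
rewrite (big_morph (meval (v ord0)) (mevalM _) (meval1 _)).
by apply: eq_bigr => i _; rewrite mevalXU.
Qed.

Lemma form_of_mpoly d (p : {mpoly E[k]}) : p \is d.-homog ->
  exists phi : d.-tuple 'I_k -> E, forall v : 'rV_k, p.@[v ord0] = form_at phi v.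
Proof.
move=> /dhomogP ph.
(* A monomial is listed as a tuple in which each variable is repeated as often as its exponent;
   [phi] puts the coefficient on that single tuple. *)
have tup (m : 'X_{1..k}) : mdeg m = d -> exists t : d.-tuple 'I_k,
    forall v : 'rV[E]_k, \prod_i v ord0 i ^+ m i = \prod_(i <- t) v ord0 i.
  move=> md; pose s := flatten [seq nseq (m i) i | i <- enum 'I_k].
  have /eqP sz : size s == d.
    rewrite size_flatten /shape -map_comp sumnE big_map -md mdegE big_enum /=.
    by apply/eqP/eq_bigr => i _; rewrite /= size_nseq.
  exists (tcast sz (in_tuple s)) => v; rewrite val_tcast /= big_flatten big_map big_enum /=.
  by apply: eq_bigr => i _; rewrite big_nseq iter_mulr_1.
suff: forall s : seq 'X_{1..k}, {in s, forall m, mdeg m = d} ->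
    exists phi : d.-tuple 'I_k -> E, forall v : 'rV_k,
      \sum_(m <- s) p@_m * \prod_i v ord0 i ^+ m i = form_at phi v.
  by move=> /(_ _ ph) [phi hphi]; exists phi => v; rewrite mevalE hphi.
elim=> [|m s IH] hs.
  exists (fun=> 0) => v; rewrite big_nil /form_at big1 // => u _; exact: mul0r.
have [|phi hphi] := IH; first by move=> m' m's; apply: hs; rewrite inE m's orbT.
have [t ht] := tup m (hs m (mem_head _ _)).
exists (fun u => p@_m * (u == t)%:R + phi u) => v; rewrite big_cons hphi ht /form_at.
under [RHS]eq_bigr do rewrite mulrDl; rewrite big_split; congr (_ + _).
rewrite (bigD1 t) //= eqxx mulr1 ffunE [X in _ + X]big1 ?addr0 // => u /negPf ->.
by rewrite mulr0 mul0r.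
Qed.

End Tensors.

Arguments tslice {E k} b N.

(** * Growth of the Hilbert function along a chain of irreducible closed sets *)

Section Chains.
Variables (E : fieldType) (k : nat).
Implicit Types (Z C : pset E k).

(** Pairing with the power of [v] evaluates a form at [v], so this space is dual to the forms of
    degree [N] modulo those vanishing on [Z], and its dimension is the Hilbert function of [Z]. *)
Definition tpow_span Z N : {vspace tens E k N} :=
  cspan (fun x => exists2 v, Z v & x = tpow N v).

Lemma zclosed_root (p : {mpoly E[k]}) d : p \is d.-homog ->
  zclosed (fun v => v != 0 /\ p.@[v ord0] = 0).
Proof.
move=> ph; exists (fun q => q = p); split=> [_ ->|v]; first by exists d.
by split=> -[v0 pv]; split=> //; [move=> q -> | exact: pv].
Qed.

Lemma irreducible_mul Z (p q : {mpoly E[k]}) d e :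
  irreducible Z -> (forall v, Z v -> v != 0) -> p \is d.-homog -> q \is e.-homog ->
  (forall v, Z v -> p.@[v ord0] * q.@[v ord0] = 0) ->
  (forall v, Z v -> p.@[v ord0] = 0) \/ (forall v, Z v -> q.@[v ord0] = 0).
Proof.
move=> [_ irrZ] Z0 ph qh pq0.
have [v Zv| sub | sub] := irrZ _ _ (zclosed_root ph) (zclosed_root qh).
- have /eqP := pq0 v Zv; rewrite mulf_eq0 => /orP[] /eqP ->; [left|right]; split=> //; exact: Z0.
- by left=> v /sub[].
- by right=> v /sub[].
Qed.

(** Contract with [p]. The kernel contains the powers of the points of [Z], where [p] vanishes. The
    image contains all powers of points of [Z']: otherwise a form [q] would kill the image but not
    some power, so [p * q] would vanish on [Z'] while neither factor does, against
    irreducibility. *)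
Lemma dim_tpow_span_step Z Z' (p : {mpoly E[k]}) d N N' :
  irreducible Z' -> (forall v, Z' v -> v != 0) -> psub Z Z' -> p \is d.-homog ->
  (forall v, Z v -> p.@[v ord0] = 0) -> ~ (forall v, Z' v -> p.@[v ord0] = 0) ->
  N' = (d + N)%N ->
  (\dim (tpow_span Z' N) + \dim (tpow_span Z N') <= \dim (tpow_span Z' N'))%N.
Proof.
move=> irrZ' Z'0 ZZ' ph pZ pZ' ->{N'}.
have [phi hphi] := form_of_mpoly ph.
rewrite addnC -(limg_ker_dim (tform phi N) (tpow_span Z' (d + N))); apply: leq_add.
  apply/dimvS/cspan_sub => _ [v Zv ->]; rewrite memv_cap memv_ker tform_tpow -hphi pZ //.
  by rewrite scale0r eqxx andbT; apply: mem_cspan; exists v => //; apply: ZZ'.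
apply/dimvS/cspan_sub => _ [v Zv ->]; apply/negP => /negP vU.
have [psi [psi0 /negP[]]] := separating_functional vU.
have [q qh hq] := mpoly_of_form psi.
have [u Zu||qZ'] := irreducible_mul irrZ' Z'0 ph qh; last 2 first.
- by move/pZ'.
- by have := qZ' v Zv; rewrite hq => /eqP.
rewrite hq hphi; have := psi0 (form_at phi u *: tpow N u).
rewrite -tform_tpow => <-; last by apply/memv_img/mem_cspan; exists u.
rewrite mulr_sumr; apply: eq_bigr => t _.
by rewrite tform_tpow [in RHS]ffunE /GRing.scale /= mulrCA.
Qed.

Lemma closed_in_form C Z Z' : (forall v, C v -> v != 0) ->
  irreducible Z -> closed_in C Z -> closed_in C Z' -> pproper Z Z' ->
  exists d (p : {mpoly E[k]}), [/\ (0 < d)%N, p \is d.-homog,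
    forall v, Z v -> p.@[v ord0] = 0 & ~ (forall v, Z' v -> p.@[v ord0] = 0)].
Proof.
move=> C0 [[w Zw] _] [T [P [Ph hT]] ZT] [T' _ ZT'] [_ nsub].
have [v Hv] := not_all_ex_not _ _ nsub; have [Z'v nZv] := imply_to_and _ _ Hv.
have Cv : C v by case/ZT': Z'v.
have nTv : ~ T v by move=> Tv; apply: nZv; apply/ZT.
have nP : ~ forall p, P p -> p.@[v ord0] = 0.
  by move=> h; apply: nTv; apply/hT; split=> //; exact: C0.
have [p Hp] := not_all_ex_not _ _ nP; have [Pp pv] := imply_to_and _ _ Hp.
have [d ph] := Ph p Pp.
have pZ u : Z u -> p.@[u ord0] = 0 by case/ZT=> _ /hT[_ /(_ p Pp)].
exists d, p; split=> //; last by move/(_ v Z'v).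
(* Degree 0 is excluded: a constant that vanishes at the point [w] of [Z] vanishes at [v] too. *)
case: d ph => // /dhomogP p0; case: pv; rewrite -(pZ w Zw) !mevalE.
rewrite !big_seq; apply: eq_bigr => m /p0 /eqP; rewrite mdeg_eq0 => /eqP ->.
by congr (_ * _); apply: eq_bigr => i _; rewrite mnm0E !expr0.
Qed.

(** Induction on [r], with Pascal's recursion in [n]. The free factor [e] allows the step between
    consecutive degrees to be any multiple of [D], so that two levels of the chain can use a common
    step. *)
Lemma chain_dim C (Z : nat -> pset E k) r :
  (forall v, C v -> v != 0) ->
  (forall i, (i <= r)%N -> irreducible (Z i) /\ closed_in C (Z i)) ->
  (forall i, (i < r)%N -> pproper (Z i) (Z i.+1)) ->
  exists2 D, (0 < D)%N & forall e, (0 < e)%N -> forall n,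
    ('C(n + r, r) <= \dim (tpow_span (Z r) (n * (D * e))))%N.
Proof.
move=> C0; elim: r => [|r IH] irrZ ZZ.
  exists 1%N => // e _ n; rewrite bin0 lt0n dimv_eq0; apply/eqP => U0.
  have [[[v Zv] _] [T _ ZT]] := irrZ 0 isT.
  have /eqP : tpow (n * (1 * e)) v = 0.
    by apply/eqP; rewrite -memv0 -U0; apply: mem_cspan; exists v.
  have /C0 : C v by case/ZT: Zv.
  move=> v0 /eqP/ffunP t0; have [i vi] : exists i, v 0 i != 0.
    apply/existsP; apply: contraNT v0; rewrite negb_exists => /forallP v0.
    by apply/eqP/rowP => i; rewrite mxE; apply/eqP/negPn.
  have := t0 (nseq_tuple _ i); rewrite !ffunE big_nseq iter_mulr_1 => /eqP.
  by rewrite expf_eq0 (negPf vi) andbF.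
have [i ir|i ir|D D0 HD] := IH; [by apply/irrZ/leqW|by apply/ZZ/leqW|].
have [irr1 cl1] := irrZ r.+1 (leqnn _); have [irr0 cl0] := irrZ r (leqW (leqnn _)).
have pr := ZZ r (ltnSn _).
have [d [p [d0 ph p0 p1]]] := closed_in_form C0 irr0 cl0 cl1 pr.
have Z0 v : Z r.+1 v -> v != 0 by case: cl1 => T _ ZT /ZT[/C0].
(* The separating form [p] has degree [d], so [p ^+ (D * e)] has exactly the degree of the new step;
   the induction hypothesis is used with [d * e] in place of [e]. *)
exists (D * d)%N => [|e e0 n]; first by rewrite muln_gt0 D0.
have De : (0 < D * e)%N by rewrite muln_gt0 D0.
have pZ v : Z r v -> (p ^+ (D * e)).@[v ord0] = 0.
  by move=> /p0 pv; rewrite rmorphXn /= pv expr0n eqn0Ngt De.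
have pZ' : ~ (forall v, Z r.+1 v -> (p ^+ (D * e)).@[v ord0] = 0).
  by move=> h; apply: p1 => v /h /eqP; rewrite rmorphXn /= expf_eq0 => /andP[_ /eqP].
elim: n => [|n IHn].
  have := HD (d * e)%N; rewrite muln_gt0 d0 e0 => /(_ isT 0%N).
  rewrite !add0n !binn !mul0n => /leq_trans; apply; apply/dimvS/cspan_sub => _ [v Zv ->].
  by apply: mem_cspan; exists v => //; apply: (proj1 pr).
have := dim_tpow_span_step irr1 Z0 (proj1 pr) (dhomogMn (D * e) ph) pZ pZ'.
move=> /(_ (n * (D * d * e)) (n.+1 * (D * d * e)))%N H.
apply: leq_trans (H _); last by rewrite mulSn mulnAC (mulnC (D * e)%N).
rewrite addnS addSn binS; apply: leq_add; first by rewrite -addnS; exact: IHn.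
by rewrite -addSn -mulnA; apply: HD; rewrite muln_gt0 d0.
Qed.

End Chains.

(** * Pluecker indices and minors *)

Section Indices.
Variables l m : nat.
Local Notation k := 'C(m, l).
Implicit Types i j b c : 'I_k.

Definition ix i : 'I_l -> 'I_m := tnth (val (coord_idx i)).

Lemma coord_idx_bij : bijective (@coord_idx l m).
Proof.
exists (fun a => cast_ord (card_midx l m) (enum_rank a)) => [i|a]; rewrite /coord_idx.
  by rewrite enum_valK cast_ordKV.
by rewrite cast_ordK enum_rankK.
Qed.

Lemma ix_lt i (a a' : 'I_l) : (a < a')%N -> (ix i a < ix i a')%N.
Proof.
move=> aa'; have x0 : 'I_m := ix i a.
have := sorted_ltn_nth ltn_trans 0 (valP (coord_idx i)) => /(_ a a').
rewrite !inE !size_map !size_tuple !ltn_ord => /(_ isT isT aa').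
by rewrite !(nth_map x0) ?size_tuple // -!tnth_nth.
Qed.

Lemma ix_strict_inj (i : 'I_k) : injective (ix i).
Proof.
move=> a b ab.
apply: ord_inj.
have := ix_lt i (a := a) (a' := b).
have := ix_lt i (a := b) (a' := a).
rewrite ab ltnn.
by case: ltngtP => // _ h h'; [have := h isT | have := h' isT].
Qed.

Lemma ix_le i (a a' : 'I_l) : (a <= a')%N -> (ix i a <= ix i a')%N.
Proof. by rewrite leq_eqVlt => /orP[/eqP/val_inj -> // | /(ix_lt i)/ltnW]. Qed.

Lemma ix_ge i (a : 'I_l) : (a <= ix i a)%N.
Proof.
case: a => a; elim: a => [//|a IH] al.
by apply: leq_ltn_trans (IH (ltnW al)) _; exact: ix_lt.
Qed.

Lemma ix_surj (f : 'I_l -> 'I_m) : (forall a a' : 'I_l, (a < a')%N -> (f a < f a')%N) ->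
  exists i, ix i =1 f.
Proof.
move=> fm; have [g _ gK] := coord_idx_bij.
have fs : sorted ltn [seq val x | x <- [tuple f a | a < l]].
  rewrite /= -map_comp; apply: (homo_sorted (e := relpre val ltn)); first exact: fm.
  by rewrite -sorted_map val_enum_ord iota_ltn_sorted.
exists (g (exist _ [tuple f a | a < l] fs)) => a.
by rewrite /ix gK tnth_mktuple.
Qed.

Lemma ix_inj i j : ix i =1 ix j -> i = j.
Proof. by move=> ij; apply: (bij_inj coord_idx_bij); apply/val_inj/eq_from_tnth. Qed.

Lemma ix_perm (f : 'I_l -> 'I_m) : injective f ->
  exists i (s : 'S_l), forall a, f a = ix i (s a).
Proof.
move=> finj; pose t := [tuple f a | a < l].
pose r (x y : 'I_m) := (x <= y)%N.
have st : size (sort r t) == l by rewrite size_sort size_tuple.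
have /tuple_permP [s /= hs] : perm_eq t (Tuple st) by rewrite /= perm_sym perm_sort.
have us : uniq (sort r t) by rewrite sort_uniq map_inj_uniq ?enum_uniq.
have ss : sorted ltn [seq val x | x <- sort r t].
  rewrite ltn_sorted_uniq_leq map_inj_uniq ?us //=; last exact: val_inj.
  by rewrite sorted_map; apply: sort_sorted => x y; exact: leq_total.
have [g _ gK] := coord_idx_bij.
exists (g (exist _ (Tuple st) ss)), s => a.
rewrite /ix gK /= -[LHS](tnth_mktuple f) -/t.
have -> : t = [tuple tnth (Tuple st) (s a) | a < l] by apply: val_inj.
by rewrite tnth_mktuple.
Qed.

(* [bru] is the Bruhat order, and [sm] is, up to a constant, the dimension of the Schubert variety. *)
Definition bru i j := [forall a, ix i a <= ix j a]%N.
Definition sm i : nat := \sum_a ix i a.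

Lemma bruP i j : reflect (forall a, (ix i a <= ix j a)%N) (bru i j).
Proof. exact: forallP. Qed.

Lemma bru_refl i : bru i i. Proof. exact/bruP. Qed.

Lemma bru_trans j i c : bru i j -> bru j c -> bru i c.
Proof. by move=> /bruP ij /bruP jc; apply/bruP => a; apply: leq_trans (jc a). Qed.

Lemma bru_sm i j : bru i j -> i != j -> (sm i < sm j)%N.
Proof.
move=> /bruP ij; rewrite ltn_neqAle [X in _ && X]leq_sum ?andbT //; apply: contra => /eqP e.
apply/eqP/ix_inj => a; apply/val_inj/eqP; rewrite eqn_leq ij /=.
move: e; rewrite /sm (bigD1 a) //= [RHS](bigD1 a) //= => e.
have le : (\sum_(a' | a' != a) ix i a' <= \sum_(a' | a' != a) ix j a')%N by apply: leq_sum.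
by rewrite leqNgt; apply/negP => lt; have := leq_add lt le; rewrite addSn e ltnn.
Qed.

(** Let the entry of [c] at [a0] exceed that of [b]. Some [a <= a0] has [a0 <= s a], since otherwise
    [s] would inject a set of [a0 + 1] elements into one of [a0]; monotonicity of the entries then
    gives the inequality at [a]. *)
Lemma bru_pigeonhole b c (s : 'S_l) : ~~ bru c b -> exists a, (ix b a < ix c (s a))%N.
Proof.
rewrite negb_forall => /existsP[a0]; rewrite -ltnNge => h0.
have [/existsP[a /andP[aa0 sa]]|] := boolP [exists a : 'I_l, (a <= a0)%N && (a0 <= s a)%N].
  exists a; apply: leq_ltn_trans (ix_le b aa0) (leq_trans h0 (ix_le c sa)).
rewrite negb_exists => /forallP H.
have lt_card (n : nat) : (n <= l)%N -> #|[set a : 'I_l | a < n]%N| = n.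
  move=> nl; rewrite -[RHS]card_ord -[RHS](card_imset predT (f := widen_ord nl)).
    2: by move=> x y [] /val_inj.
  apply: eq_card => a; rewrite inE; apply/idP/imsetP => [an|[b' _ ->]]; last exact: (valP b').
  by exists (Ordinal an) => //; exact: val_inj.
have : (#|s @: [set a : 'I_l | a < a0.+1]%N| <= #|[set a : 'I_l | a < a0]%N|)%N.
  apply/subset_leq_card/subsetP => _ /imsetP[a + ->]; rewrite !inE ltnS => aa0.
  by have := H a; rewrite aa0 /= -ltnNge.
by rewrite (card_imset _ perm_inj) !lt_card ?ltnn // ltnW.
Qed.

(** * Minors with unsorted columns and exchange of one column *)

Section Minors.
Variable E : fieldType.
Implicit Types (W : 'M[E]_(l, m)).

Definition minor W (f : 'I_l -> 'I_m) : E := \det (colsub f W).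

Lemma pluckerE W i : plucker W ord0 i = minor W (ix i).
Proof. by rewrite mxE. Qed.

Lemma minor_perm W (f : 'I_l -> 'I_m) i (s : 'S_l) :
  (forall a, f a = ix i (s a)) -> minor W f = (-1) ^+ s * plucker W ord0 i.
Proof.
move=> fs; rewrite pluckerE /minor (_ : colsub f W = col_perm s (colsub (ix i) W)).
  by rewrite col_permE det_mulmx det_perm odd_permV mulrC.
by apply/matrixP => a a'; rewrite !mxE fs.
Qed.

Lemma minor_noninj W (f : 'I_l -> 'I_m) : ~ injective f -> minor W f = 0.
Proof.
move=> /injectiveP/injectivePn[a [a' aa' faa']].
rewrite /minor -det_tr; apply: (determinant_alternate aa') => b.
by rewrite !mxE faa'.
Qed.

(** Sorting the columns costs a sign. If a column is repeated the minor vanishes, and [i0] serves as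
    the index with coefficient 0. *)
Lemma minor_sort (i0 : 'I_k) (f : 'I_l -> 'I_m) : exists (e : E) i,
  (forall W, minor W f = e * plucker W ord0 i) /\
  (e = 0 \/ (sm i = \sum_a f a)%N).
Proof.
have [/ix_perm[i [s fs]]|ninj] := classic (injective f).
  exists ((-1) ^+ s), i; split=> [W|]; first exact: minor_perm.
  right; rewrite /sm (reindex_inj (@perm_inj _ s)) /=.
  by apply: eq_bigr => a _; rewrite fs.
by exists 0, i0; split=> [W|]; [rewrite mul0r minor_noninj | left].
Qed.

Lemma det_bru0 (N : 'M[E]_l) b c : ~~ bru c b ->
  (forall a a', (ix b a < ix c a')%N -> N a a' = 0) -> \det N = 0.
Proof.
move=> cb N0; rewrite /determinant big1 // => s _.
have [a ha] := bru_pigeonhole s cb.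
by rewrite (bigD1 a) //= N0 // mul0r mulr0.
Qed.

(* the index obtained from b by putting j at position a, without sorting *)
Definition exch b (a : 'I_l) (j : 'I_m) (a' : 'I_l) := if a' == a then j else ix b a'.

(** Cramer's rule, by expansion along the exchanged column. *)
Lemma adj_mul_minor W b a (j : 'I_m) :
  (\adj (colsub (ix b) W) *m W) a j = minor W (exch b a j).
Proof.
rewrite mxE /minor (expand_det_col _ a); apply: eq_bigr => i _.
rewrite !mxE /exch eqxx mulrC; congr (_ * (_ * \det _)).
by apply/matrixP => x y; rewrite !mxE eq_sym (negPf (neq_lift _ _)).
Qed.

Lemma sum_exch b a (j : 'I_m) : (\sum_a' exch b a j a' + ix b a = sm b + j)%N.
Proof.
rewrite /sm (bigD1 a) //= [in RHS](bigD1 a) //= /exch eqxx.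
rewrite (eq_bigr (fun a' => val (ix b a'))) => [|a' /negPf -> //].
by rewrite /= addnC addnA addnAC.
Qed.

Lemma exch_minor b a (j : 'I_m) : exists (e : E) i,
  (forall W, minor W (exch b a j) = e * plucker W ord0 i) /\
  ((ix b a < j)%N -> e = 0 \/ (sm b < sm i)%N).
Proof.
have [e [i [h1 h2]]] := minor_sort b (exch b a j); exists e, i; split=> // bj.
by case: h2 => [->|h2]; [left | right; have := sum_exch b a j; rewrite -h2; lia].
Qed.

End Minors.

End Indices.

(** * The Hilbert function of a linear section *)

Section Hilbert.
Context {E : fieldType} {l m : nat}.
Local Notation k := 'C(m, l).

(** No rank condition is imposed on [W], so stability under a matrix acting on the columns of [W]
    needs no check of rank. *)
Definition cone : pset E k := fun v => exists W : 'M[E]_(l, m), v = plucker W.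

Definition veronese N := tpow_span cone N.

(** A linear relation between coordinates is encoded as an operator into functions on [unit]; it
    then suffices to check it on powers. *)
Lemma veronese_sym N (x : tens E k N) (t t' : N.-tuple 'I_k) :
  x \in veronese N -> perm_eq t t' -> x t = x t'.
Proof.
move=> xD tt'; pose f := kop (fun (_ : unit) u => (u == t)%:R - (u == t')%:R : E).
have fE y : f y tt = y t - y t'.
  rewrite kopE; under eq_bigr do rewrite mulrBl; rewrite sumrB; congr (_ - _).
    by rewrite (bigD1 t) //= eqxx mul1r big1 ?addr0 // => u /negPf ->; rewrite mul0r.
  by rewrite (bigD1 t') //= eqxx mul1r big1 ?addr0 // => u /negPf ->; rewrite mul0r.
have /ffunP /(_ tt) : f x = 0.
  apply: cspan_ker xD => _ [v _ ->]; apply/ffunP => -[]; rewrite fE !ffunE.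
  by rewrite (perm_big _ tt') subrr.
by rewrite fE ffunE => /eqP; rewrite subr_eq0 => /eqP.
Qed.

Lemma veronese_slice b N x : x \in veronese N.+1 -> tslice b N x \in veronese N.
Proof.
move=> xD; rewrite memv_preim; move: x xD; apply/subvP/cspan_sub => _ [v Xv ->].
by rewrite -memv_preim tslice_tpow rpredZ //; apply: mem_cspan; exists v.
Qed.

Definition cone_stable (G : 'M[E]_k) := forall v, cone v -> cone (v *m G).

Lemma veronese_act G N x : cone_stable G -> x \in veronese N -> tact G N x \in veronese N.
Proof.
move=> sG xD; rewrite memv_preim; move: x xD; apply/subvP/cspan_sub => _ [v Xv ->].
by rewrite -memv_preim tact_tpow; apply: mem_cspan; exists (v *m G) => //; apply: sG.
Qed.

Definition section_tens q (M : 'M[E]_(k, q)) N : {vspace tens E k N.+1} :=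
  (veronese N.+1 :&: lker (tctr M N))%VS.

Lemma section_tensP q (M : 'M[E]_(k, q)) N x :
  reflect (x \in veronese N.+1 /\ forall c t, \sum_a M a c * x (cons_tuple a t) = 0)
    (x \in section_tens M N).
Proof.
rewrite memv_cap; apply: (iffP andP) => [[xD /tctr_eq0P]|[xD /tctr_eq0P]] //.
Qed.

Lemma section_tens_mulr q r (M : 'M[E]_(k, q)) (X : 'M[E]_(q, r)) N :
  (section_tens M N <= section_tens (M *m X) N)%VS.
Proof.
apply/subvP => x /section_tensP[xD xM]; apply/section_tensP; split=> // c t.
under eq_bigr do rewrite mxE mulr_suml.
rewrite exchange_big big1 //= => j _.
under eq_bigr do rewrite mulrAC.
by rewrite -mulr_suml xM mul0r.
Qed.

(** [tact G] is injective on [veronese], because [tact G'] undoes it on powers. Contracting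
    [tact G x] with [M] amounts to letting [G] act on the remaining slots of the contraction of [x]
    with [G *m M], which is zero. *)
Lemma section_tens_act q (M : 'M[E]_(k, q)) G G' N : cone_stable G -> G *m G' = 1%:M ->
  (\dim (section_tens (G *m M) N) <= \dim (section_tens M N))%N.
Proof.
move=> sG GG'; have GK x : x \in veronese N.+1 -> tact G' N.+1 (tact G N.+1 x) = x.
  move=> xD; rewrite -comp_lfunE -[RHS]id_lfunE; apply/eqP; rewrite -subr_eq0.
  rewrite -opp_lfunE -add_lfunE; apply/eqP; apply: cspan_ker xD => _ [v _ ->].
  by rewrite add_lfunE opp_lfunE id_lfunE comp_lfunE !tact_tpow -mulmxA GG' mulmx1 subrr.
rewrite -(limg_dim_eq (f := tact G N.+1)); last first.
  apply/eqP; rewrite -subv0; apply/subvP => x; rewrite memv_cap memv0 memv_ker.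
  by case/andP => /section_tensP[xD _] /eqP Gx; rewrite -(GK x xD) Gx linear0.
apply/dimvS/subvP => _ /memv_imgP[x /section_tensP[xD xM] ->].
apply/section_tensP; split=> [|c t]; first exact: veronese_act.
under eq_bigr do rewrite kopE sum_tuple_cons mulr_sumr.
rewrite exchange_big /=.
transitivity (\sum_(s : N.-tuple 'I_k) (\prod_(p <- zip s t) G p.1 p.2) *
    \sum_a (G *m M) a c * x (cons_tuple a s)); last first.
  by rewrite big1 // => s _; rewrite xM mulr0.
under eq_bigr do under eq_bigr do rewrite mulr_sumr.
under [RHS]eq_bigr do rewrite mulr_sumr.
rewrite [RHS]exchange_big; apply: eq_bigr => b _ /=.
rewrite exchange_big; apply: eq_bigr => s _ /=.
rewrite mxE mulr_suml mulr_sumr; apply: eq_bigr => a _; rewrite big_cons /=.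
by rewrite -!mulrA [LHS]mulrCA [RHS]mulrCA; congr (_ * _); rewrite mulrCA.
Qed.

(** Vanishing is required as soon as any slot leaves [A], so the definition also covers degree 0; in
    positive degree the first slot suffices, by symmetry. *)
Definition coord_tens (A : {set 'I_k}) N : {vspace tens E k N} :=
  (veronese N :&: lker (kop (fun t u : N.-tuple 'I_k =>
     (has [pred i | i \notin A] t && (u == t))%:R)))%VS.

Lemma coord_tensP (A : {set 'I_k}) N x : reflect
  (x \in veronese N /\ forall t : N.-tuple 'I_k, has [pred i | i \notin A] t -> x t = 0)
  (x \in coord_tens A N).
Proof.
have E1 t : kop (fun t u : N.-tuple 'I_k =>
     (has [pred i | i \notin A] t && (u == t))%:R) x t = (has [pred i | i \notin A] t)%:R * x t.
  rewrite kopE (bigD1 t) //= eqxx andbT big1 ?addr0 // => u /negPf ->.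
  by rewrite andbF mul0r.
rewrite memv_cap memv_ker; apply: (iffP andP) => [[xD /eqP/ffunP x0]|[xD x0]]; split=> //.
  by move=> t ht; have := x0 t; rewrite E1 ht mul1r ffunE.
apply/eqP/ffunP => t; rewrite E1 [RHS]ffunE; case: (boolP (has _ _)) => [/x0 ->|_].
  by rewrite mulr0.
by rewrite mul0r.
Qed.

Lemma coord_tens1P (A : {set 'I_k}) N x : reflect
  (x \in veronese N.+1 /\ forall i (t : N.-tuple 'I_k), i \notin A -> x (cons_tuple i t) = 0)
  (x \in coord_tens A N.+1).
Proof.
apply: (iffP (coord_tensP _ _)) => -[xD x0]; split=> //.
  by move=> i t iA; apply: x0; rewrite /= iA.
move=> t /hasP[i it iA].
have sz : size (rem i t) == N by rewrite size_rem // size_tuple.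
rewrite (veronese_sym (t' := cons_tuple i (Tuple sz)) xD) ?x0 //.
exact: perm_to_rem.
Qed.

Definition coord_mx (A : {set 'I_k}) : 'M[E]_k := \matrix_(i, j) ((i == j) && (j \notin A))%:R.

Lemma coord_mx_tens (A : {set 'I_k}) N : section_tens (coord_mx A) N = coord_tens A N.+1.
Proof.
apply/vspaceP => x; apply/section_tensP/coord_tens1P => -[xD x0]; split=> //.
  move=> i t iA; rewrite -(x0 i t) (bigD1 i) //= mxE eqxx iA mul1r big1 ?addr0 // => j /negPf ji.
  by rewrite mxE ji mul0r.
move=> j t; rewrite big1 // => i _; rewrite mxE.
by case: eqP => [->|]; last rewrite mul0r; case: (boolP (j \in A)) => jA; rewrite ?mul0r //= x0 ?mulr0.
Qed.

End Hilbert.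

Lemma section_semicont (E : closedFieldType) (l m q : nat) (M : 'M[{poly E}]_('C(m, l), q)) N b :
    (forall c, c != 0 -> (b <= \dim (section_tens (map_mx (horner_eval c) M) N))%N) ->
  (b <= \dim (section_tens (map_mx (horner_eval 0) M) N))%N.
Proof.
have ctrE c : tctr (map_mx (horner_eval c) M) N = kop (fun ct u => (ctr_coef M ct u).[c]).
  by apply: eq_kop => ct u; rewrite /ctr_coef; case: ifP => _; rewrite ?mxE ?horner0.
move=> hb; rewrite /section_tens ctrE; apply: kop_ker_semicont => c c0.
by rewrite -ctrE; apply: hb.
Qed.

(** * Degeneration to a coordinate space *)

Lemma binary_inj n (f g : 'I_n -> bool) :
  (\sum_i f i * 2 ^ i = \sum_i g i * 2 ^ i)%N -> f =1 g.
Proof.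
elim: n f g => [|n IH] f g; first by move=> _ [].
rewrite !big_ord_recl /= !muln1.
have shift (h : 'I_n.+1 -> bool) :
    (\sum_(i < n) h (lift ord0 i) * 2 ^ bump 0 i = (\sum_(i < n) h (lift ord0 i) * 2 ^ i).*2)%N.
  rewrite -muln2 big_distrl; apply: eq_bigr => i _.
  by rewrite /= /bump leq0n add1n expnSr mulnA.
rewrite !shift => e.
have /= e0 := congr1 odd e; rewrite !oddD !odd_double !addbF !oddb in e0.
have e1 : (\sum_(i < n) f (lift ord0 i) * 2 ^ i = \sum_(i < n) g (lift ord0 i) * 2 ^ i)%N.
  by apply: double_inj; move: e; rewrite e0 => /addnI.
by move=> i; case: (unliftP ord0 i) => [j ->|-> //]; exact: (IH _ _ e1).
Qed.

Section TorusLimit.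
Variables (E : closedFieldType) (l m : nat).
Local Notation k := 'C(m, l).

(** Weight of a coordinate under the one-parameter torus scaling column [x] by [c ^+ (2 ^ x)].
    Binary expansions are unique, so distinct indices get distinct weights. *)
Definition wt (i : 'I_k) : nat := (\sum_a 2 ^ ix i a)%N.

Lemma wtE i : wt i = (\sum_(x < m) (x \in codom (ix i)) * 2 ^ x)%N.
Proof.
rewrite (bigID (mem (codom (ix i)))) /= [X in (_ + X)%N]big1 ?addn0 => [|x /negPf -> //].
rewrite (eq_bigr (fun x : 'I_m => 2 ^ x)%N) => [|x ->]; last by rewrite mul1n.
have U : uniq (codom (ix i)) by rewrite map_inj_uniq ?enum_uniq //; exact: ix_strict_inj.
by rewrite -(big_uniq _ U) /= big_map big_enum.
Qed.

Lemma wt_inj : injective wt.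
Proof.
move=> i j; rewrite !wtE => /binary_inj ij.
apply: (bij_inj (@coord_idx_bij l m)); apply/val_inj/val_inj/(inj_map val_inj).
apply: (irr_sorted_eq ltn_trans ltnn (valP (coord_idx i)) (valP (coord_idx j))) => x.
have cE (i' : 'I_k) : val (val (coord_idx i')) = codom (ix i').
  exact/esym/(map_tnth_enum (val (coord_idx i'))).
rewrite !cE; apply: (eq_mem_map val); exact: ij.
Qed.

Definition torus_mx (c : E) : 'M[E]_k := diag_mx (\row_i c ^+ wt i).

Lemma torus_stable c : cone_stable (torus_mx c).
Proof.
move=> _ [W ->]; exists (W *m diag_mx (\row_x c ^+ (2 ^ x))); apply/rowP => i.
rewrite mul_mx_diag !mxE.
have -> : colsub (tnth (val (coord_idx i))) (W *m diag_mx (\row_x c ^+ (2 ^ x))) =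
   colsub (ix i) W *m diag_mx (\row_a c ^+ (2 ^ ix i a)).
  by rewrite !mul_mx_diag; apply/matrixP => a b; rewrite !mxE.
rewrite det_mulmx det_diag; congr (_ * _); rewrite /wt -prodrXr.
by apply: eq_bigr => a _; rewrite mxE.
Qed.

Lemma torus_mxV c : c != 0 -> torus_mx c^-1 *m torus_mx c = 1%:M.
Proof.
move=> c0; rewrite /torus_mx mulmx_diag -diag_const_mx; congr diag_mx; apply/rowP => i.
by rewrite !mxE exprVn mulVf // expf_neq0.
Qed.

Lemma torus_mxE c d (N : 'M[E]_k) i j :
  (torus_mx c *m N *m torus_mx d) i j = c ^+ wt i * N i j * d ^+ wt j.
Proof. by rewrite mul_mx_diag mul_diag_mx !mxE. Qed.

(* The initial subspace of ker M for the weights wt: the rows picked greedily by increasing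
   weight are the leading terms of the linear forms vanishing on it. *)
Lemma torus_limit q (M : 'M[E]_(k, q)) : exists A : {set 'I_k},
  (#|A| + \rank M <= k)%N /\
  (forall N, (\dim (section_tens M N) <= \dim (coord_tens (E := E) A N.+1))%N).
Proof.
(* [B] consists of the pivot rows, those outside the span [S i] of the rows of smaller weight. The
   vector [x i] takes the value 1 on the pivot row [i] and 0 on every row of smaller weight. *)
pose S i := (\sum_(j | (wt j < wt i)%N) <<row j M>>)%MS.
pose B := [set i | ~~ (row i M <= S i)%MS].
have /fin_all_exists [x hx] : forall i, exists x : 'cV[E]_q, i \in B ->
    (row i M *m x = 1%:M) /\ (forall j, (wt j < wt i)%N -> row j M *m x = 0).
  move=> i; have [iB|] := boolP (i \in B); last by exists 0.
  have : row i M *m cokermx (S i) != 0 by move: iB; rewrite inE submxE.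
  case/rV0Pn => c hc; pose y := (row i M *m cokermx (S i)) 0 c.
  exists (y^-1 *: col c (cokermx (S i))) => _; split=> [|j ji]; rewrite -scalemxAr colE mulmxA -colE.
    by apply/matrixP => a b; rewrite !ord1 mxE [X in _ * X]mxE mulVf // mxE.
  suff /eqP -> : row j M *m cokermx (S i) == 0 by rewrite col0 scaler0.
  rewrite -submxE; apply: (submx_trans (B := <<row j M>>%MS)); first by rewrite genmxE.
  exact: sumsmx_sup ji (submx_refl _).
pose T : 'M[E]_(#|B|, q) := \matrix_r row (enum_val r) M.
(* By induction on the weight every row lies in the span of the pivot rows, hence [M] has rank at
   most [#|B|]. *)
have MT i : (row i M <= T)%MS.
  have [n] := ubnP (wt i); elim: n i => // n IH i; rewrite ltnS => wn.
  have [iB|] := boolP (i \in B).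
    rewrite (_ : row i M = row (enum_rank_in iB i) T) ?row_sub //.
    by rewrite rowK enum_rankK_in.
  rewrite inE negbK => /submx_trans; apply; apply/sumsmx_subP => j ji.
  by rewrite genmxE; apply: IH; apply: leq_trans ji _.
exists (~: B); split.
  have rk : (\rank M <= #|B|)%N.
    by apply: leq_trans (mxrankS _) (rank_leq_row T); apply/row_subP.
  by rewrite -[X in (_ <= X)%N]card_ord -(cardsC B) addnC leq_add2r.
(* [M *m X] is triangular for the weights, with the indicator of [B] on the diagonal. *)
move=> N; pose X := \matrix_(a, j) (if j \in B then x j a 0 else 0).
have XE i j : (M *m X) i j = if j \in B then (row i M *m x j) 0 0 else 0.
  rewrite mxE; case: ifP => jB; last by rewrite big1 // => a _; rewrite mxE jB mulr0.
  by rewrite !mxE; apply: eq_bigr => a _; rewrite !mxE jB.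
have X0 i j : (wt i < wt j)%N -> (M *m X) i j = 0.
  by rewrite XE; case: ifP => // jB /(proj2 (hx j jB)) ->; rewrite mxE.
have X1 i : (M *m X) i i = (i \in B)%:R.
  by rewrite XE; case: ifP => // iB; rewrite (proj1 (hx i iB)) mxE.
(* For [c != 0] this specialises to the conjugate of [M *m X] by the torus; at 0 only the diagonal
   survives. The truncated exponent is harmless, since the entries with [wt i < wt j] are zero. *)
pose Mt : 'M[{poly E}]_k := \matrix_(i, j) (((M *m X) i j)%:P * 'X^(wt i - wt j)).
have -> : coord_tens (~: B) N.+1 = section_tens (map_mx (horner_eval 0) Mt) N.
  rewrite -coord_mx_tens.
  suff -> : coord_mx (~: B) = map_mx (horner_eval 0) Mt by [].
  apply/matrixP => i j.
  rewrite [LHS]mxE [RHS]mxE [Mt i j]mxE /horner_eval hornerM hornerC hornerXn in_setC negbK.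
  have [<-|ij] := eqVneq i j; first by rewrite X1 subnn mulr1.
  case: (ltngtP (wt i) (wt j)) => [lt|gt|/wt_inj e]; last by rewrite e eqxx in ij.
    by rewrite X0 // mul0r.
  by rewrite expr0n subn_eq0 leqNgt gt mulr0.
apply: section_semicont => c c0.
have -> : map_mx (horner_eval c) Mt = torus_mx c *m (M *m X) *m torus_mx c^-1.
  apply/matrixP => i j; rewrite torus_mxE.
  rewrite [LHS]mxE [Mt i j]mxE /horner_eval hornerM hornerC hornerXn.
  have [lt|ge] := ltnP (wt i) (wt j); first by rewrite X0 // !(mulr0, mul0r).
  by rewrite expfB_cond ?(negPf c0) // exprVn mulrA [_ * c ^+ _]mulrC.
(* Right multiplication can only enlarge the section space, so [X] and the right torus factor are
   absorbed; the left torus factor is undone by the action on tensors. *)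
apply: leq_trans (dimvS (section_tens_mulr _ _ _)).
apply: leq_trans (section_tens_act (torus_mx c *m (M *m X)) N (@torus_stable c^-1) (torus_mxV c0)).
by rewrite (mulmxA (torus_mx c^-1)) torus_mxV // mul1mx; apply/dimvS/section_tens_mulr.
Qed.

End TorusLimit.

(** * Combinatorial shifts *)

Section Shift.
Variables (l m : nat).
Local Notation k := 'C(m, l).
Implicit Types (x y : 'I_m) (i j : 'I_k).

(** The new entry keeps its position: for adjacent [x] and [y] no sorting, hence no sign,
    intervenes. *)
Definition down x y i j :=
  [exists a : 'I_l, [&& ix i a == y, ix j a == x &
     [forall a' : 'I_l, (a' != a) ==> (ix i a' == ix j a')]]].

Lemma downP x y i j : reflect
  (exists a, [/\ ix i a = y, ix j a = x & forall a', a' != a -> ix i a' = ix j a'])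
  (down x y i j).
Proof.
apply: (iffP existsP) => -[a].
  case/and3P => /eqP ia /eqP ja /forallP h; exists a; split=> // a' a'a.
  by apply/eqP; apply: (implyP (h a')).
case=> ia ja h; exists a; apply/and3P; split; [exact/eqP|exact/eqP|].
by apply/forallP => a'; apply/implyP => /h ->.
Qed.

Lemma down_sm x y i j : down x y i j -> (sm i + x = sm j + y)%N.
Proof.
case/downP => a [ia ja h]; rewrite /sm (bigD1 a) //= [in RHS](bigD1 a) //= ia ja.
rewrite (eq_bigr (fun a' => val (ix j a'))) => [|a' /h -> //].
by rewrite addnAC [RHS]addnAC [(y + x)%N]addnC.
Qed.

Lemma down_notin x y i j a : x != y -> down x y i j -> ix i a <> x.
Proof.
move=> xy /downP[a' [ia' ja' h]] ia; have [e|ne] := eqVneq a a'.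
  by move: xy; rewrite -ia e ia' eqxx.
by have := ne; rewrite -(inj_eq (@ix_strict_inj l m j)) ja' -(h a ne) ia eqxx.
Qed.

Lemma down_functional x y i j j' : down x y i j -> down x y i j' -> j = j'.
Proof.
case/downP => a [ia ja h] /downP[a' [ia' ja' h']]; apply: ix_inj => b.
have aa' : a = a' by apply: (@ix_strict_inj l m i); rewrite ia.
have [->|ba] := eqVneq b a; first by rewrite ja aa'.
by rewrite -h // h' // -aa'.
Qed.

Lemma down_injective x y i i' j : down x y i j -> down x y i' j -> i = i'.
Proof.
case/downP => a [ia ja h] /downP[a' [ia' ja' h']]; apply: ix_inj => b.
have aa' : a = a' by apply: (@ix_strict_inj l m j); rewrite ja.
have [->|ba] := eqVneq b a; first by rewrite ia aa'.
by rewrite h // -h' // -aa'.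
Qed.

Lemma up_exists x y j a : y = x.+1 :> nat -> ix j a = x -> (forall a', ix j a' <> y) ->
  exists2 i, down x y i j & forall b, ix i b = exch j a y b.
Proof.
move=> xy ja nj; have [|i hi] := @ix_surj l m (exch j a y).
  move=> b b' bb'; rewrite /exch; have := ix_lt j bb'.
  have nb' : ix j b' <> y := nj b'.
  case: (eqVneq b a) => [e|ne]; case: (eqVneq b' a) => [e'|ne'] //=.
  - by rewrite e e' ltnn.
  - rewrite e ja => lt; rewrite ltn_neqAle xy lt andbT; apply/eqP => e2.
    by apply: nb'; apply: ord_inj; rewrite -e2.
  by rewrite e' ja => lt; rewrite xy; apply: leqW.
exists i => //; apply/downP; exists a; split=> // [|a' a'a].
  by rewrite hi /exch eqxx.
by rewrite hi /exch (negPf a'a).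
Qed.

Lemma down_exists x y i a : y = x.+1 :> nat -> ix i a = y -> (forall a', ix i a' <> x) ->
  exists2 j, down x y i j & forall b, ix j b = exch i a x b.
Proof.
move=> xy ia ni; have [|j hj] := @ix_surj l m (exch i a x).
  move=> b b' bb'; rewrite /exch; have := ix_lt i bb'.
  have nb : ix i b <> x := ni b.
  case: (eqVneq b a) => [e|ne]; case: (eqVneq b' a) => [e'|ne'] //=.
  - by rewrite e e' ltnn.
  - by rewrite e ia xy => lt; apply: ltnW.
  rewrite e' ia xy ltnS => lt; rewrite ltn_neqAle lt andbT; apply/eqP => e2.
  by apply: nb; apply: ord_inj; rewrite e2.
exists j => //; apply/downP; exists a; split=> // [|a' a'a].
  by rewrite hj /exch eqxx.
by rewrite hj /exch (negPf a'a).
Qed.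

(** Lower [i] by one at the least position [a] where it exceeds [j]. If [i] already had the entry
    [ix i a - 1], it would occur at some [a' < a], where minimality gives
    [ix i a - 1 <= ix j a' < ix j a], against [ix j a < ix i a]. *)
Lemma lower_step i j : bru j i -> j != i ->
  exists x y i', [/\ y = x.+1 :> nat, down x y i i' & bru j i'].
Proof.
move=> ji ne; have /existsP ex : [exists a, ix j a < ix i a]%N.
  apply: contraNT ne; rewrite negb_exists => /forallP h; apply/eqP/ix_inj => a.
  by apply: ord_inj; apply/eqP; rewrite eqn_leq (bruP _ _ ji) leqNgt h.
have [a0 ha0] := ex.
have [a lt_a amin] := @arg_minnP _ a0 (fun a => ix j a < ix i a)%N (fun a : 'I_l => val a) ha0.
have y0 : (0 < ix i a)%N by apply: leq_ltn_trans lt_a.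
have xm : ((ix i a).-1 < m)%N by apply: leq_ltn_trans (ltn_ord (ix i a)); exact: leq_pred.
have xy : ix i a = (Ordinal xm).+1 :> nat by rewrite /= prednK.
have [|i' di' hi'] := down_exists xy (erefl (ix i a)).
  move=> a' e; have a'a : (a' < a)%N.
    by rewrite ltnNge; apply/negP => /(ix_le i); rewrite e /= leqNgt prednK // leqnn.
  have: ~~ (ix j a' < ix i a')%N by apply/negP => /amin; rewrite leqNgt a'a.
  rewrite -leqNgt e => le; have := leq_ltn_trans le (ix_lt j a'a).
  by rewrite ltnNge -ltnS -xy lt_a.
exists (Ordinal xm), (ix i a), i'; split=> //; apply/bruP => b; rewrite hi' /exch.
by case: eqVneq => [->|_]; [rewrite -ltnS -xy | exact: (bruP _ _ ji)].
Qed.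

Definition shift_closed (A : {set 'I_k}) := forall x y i j,
  y = x.+1 :> nat -> down x y i j -> i \in A -> j \in A.

Definition downset (A : {set 'I_k}) := forall i j, bru j i -> i \in A -> j \in A.

Lemma shift_closed_downset A : shift_closed A -> downset A.
Proof.
move=> sA i j; have [n] := ubnP (sm i); elim: n i => // n IH i; rewrite ltnS => sn ji iA.
have [-> //|ne] := eqVneq j i.
have [x [y [i' [xy di' ji']]]] := lower_step ji ne.
apply: IH ji' (sA _ _ _ _ xy di' iA); apply: leq_trans sn.
by have := down_sm di'; rewrite xy; lia.
Qed.

End Shift.

(** * Shears on Pluecker coordinates and their limits *)

Section ShiftLimit.
Variables (E : closedFieldType) (l m : nat) (x y : 'I_m).
Local Notation k := 'C(m, l).
Hypothesis xy : y = x.+1 :> nat.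

Lemma xy_neq : x != y. Proof. by apply/eqP => e; move: xy; rewrite e => /eqP; rewrite eqn_leq ltnn andbF. Qed.

(** The action on Pluecker coordinates of the elementary shear that adds [s] times column [y] to
    column [x]. *)
Definition shear_mx (s : E) : 'M[E]_k := \matrix_(i, j) ((i == j)%:R + s * (down x y i j)%:R).

Lemma sum_down (F : 'I_k -> E) i j : down x y i j -> \sum_i' (down x y i' j)%:R * F i' = F i.
Proof.
move=> d; rewrite (bigD1 i) //= d mul1r big1 ?addr0 // => i' ne.
case: (boolP (down x y i' j)) => [d'|_]; last by rewrite mul0r.
by rewrite (down_injective d' d) eqxx in ne.
Qed.

Lemma shear_mul s (v : 'rV[E]_k) j :
  (v *m shear_mx s) 0 j = v 0 j + s * \sum_i (down x y i j)%:R * v 0 i.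
Proof.
rewrite mxE; under eq_bigr do rewrite mxE mulrDr.
rewrite big_split /= (bigD1 j) //= eqxx mulr1 [X in _ + X + _]big1 ?addr0; last first.
  by move=> i /negPf ->; rewrite mulr0.
by congr (_ + _); rewrite mulr_sumr; apply: eq_bigr => i _; rewrite mulrCA [v 0 i * _]mulrC.
Qed.

(** The minor at [j] changes only if [j] contains [x], and then, by multilinearity, by [s] times the
    minor with column [x] replaced by column [y]. That minor has a repeated column if [j] also
    contains [y]; otherwise it is the coordinate at the index above [j]. *)
Lemma shear_stable s : cone_stable (shear_mx s).
Proof.
move=> _ [W ->]; pose g : 'M[E]_m := 1%:M + s *: delta_mx y x.
have gE a z : (W *m g) a z = W a z + (z == x)%:R * s * W a y.
  rewrite mulmxDr mulmx1 mxE -scalemxAr; congr (_ + _).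
  rewrite mxE mxE (bigD1 y) //= !mxE eqxx big1 => [|z' /negPf ne]; last by rewrite !mxE ne mulr0.
  by rewrite addr0 /= mulrCA [LHS]mulrC [s * _]mulrC.
exists (W *m g); move: (W *m g) gE => Wg gE; apply/rowP => j; rewrite shear_mul.
rewrite [RHS]pluckerE.
have [/existsP[a /eqP ja]|nx] := boolP [exists a, ix j a == x]; last first.
  have nj a : ix j a == x = false by apply: contraNF nx => h; apply/existsP; exists a.
  rewrite big1 ?mulr0 ?addr0 => [|i _]; last first.
    by case: (boolP (down x y i j)) => [/downP[a [_ /eqP]]|_]; rewrite ?nj ?mul0r.
  rewrite pluckerE; congr (\det _); apply/matrixP => b c.
  by rewrite mxE [RHS]mxE gE nj !mul0r addr0.
have -> : minor Wg (ix j) = plucker W ord0 j + s * minor W (exch j a y).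
  rewrite pluckerE /minor -!(det_tr (colsub _ _)) -[X in X + _]mul1r.
  apply: (determinant_multilinear (i0 := a)).
  - by apply/rowP => b; rewrite !mxE gE ja eqxx /exch eqxx !mul1r.
  - apply/matrixP => b c; rewrite !mxE gE (_ : _ == x = false) ?mul0r ?addr0 //.
    by rewrite -ja (inj_eq (@ix_strict_inj l m j)) eq_sym (negPf (neq_lift _ _)).
  - apply/matrixP => b c; rewrite !mxE gE (_ : _ == x = false) ?mul0r ?addr0 /exch.
      by rewrite eq_sym (negPf (neq_lift _ _)).
    by rewrite -ja (inj_eq (@ix_strict_inj l m j)) eq_sym (negPf (neq_lift _ _)).
congr (_ + s * _).
have [/existsP[a' /eqP ja']|ny] := boolP [exists a', ix j a' == y].
  rewrite minor_noninj; last first.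
    move=> /(_ a a'); rewrite /exch eqxx ja'; case: eqVneq => [e|ne /(_ erefl) e].
      by move: xy_neq; rewrite -ja -ja' e eqxx.
    by rewrite e eqxx in ne.
  rewrite big1 // => i _; case: (boolP (down x y i j)) => [/downP[b [ib jb h]]|_]; last by rewrite mul0r.
  have ba : b = a by apply: (@ix_strict_inj l m j); rewrite jb.
  have a'b : a' != b.
    by rewrite ba; apply: contraNneq xy_neq => e; rewrite -ja -ja' e.
  have := h a' a'b; rewrite ja' -ib => /(@ix_strict_inj l m i) e.
  by rewrite e eqxx in a'b.
have [|i di hi] := up_exists xy ja.
  by move=> a' e; case/existsP: ny; exists a'; apply/eqP.
rewrite (sum_down _ di) pluckerE; congr (\det _); apply/matrixP => b c.
by rewrite !mxE hi.
Qed.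

Lemma shear_mxV s : shear_mx (- s) *m shear_mx s = 1%:M.
Proof.
apply/row_matrixP => i; rewrite row_mul; apply/rowP => j; rewrite shear_mul !mxE.
under eq_bigr => i' _ do rewrite !mxE.
have -> : \sum_i' (down x y i' j)%:R * ((i == i')%:R + - s * (down x y i i')%:R) =
    (down x y i j)%:R.
  rewrite (bigD1 i) //= eqxx big1 ?addr0 => [|i' ne].
    case: (boolP (down x y i j)) => d; last by rewrite mul0r.
    case: (boolP (down x y i i)) => [/downP[a [_ ia _]]|_]; last by rewrite mulr0 addr0 mulr1.
    by case: (down_notin xy_neq d ia).
  rewrite eq_sym (negPf ne) add0r.
  case: (boolP (down x y i' j)) => d; last by rewrite mul0r.
  case: (boolP (down x y i i')) => [/downP[a [_ ia _]]|_]; last by rewrite !mulr0.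
  by case: (down_notin xy_neq d ia).
by rewrite -addrA mulNr addNr addr0.
Qed.

(** The compression of extremal set theory: an index moves down unless its target is already
    occupied. *)
Definition shift_idx (A : {set 'I_k}) (i : 'I_k) : 'I_k :=
  if [pick j | (j \notin A) && down x y i j] is Some j then j else i.

Definition shift (A : {set 'I_k}) := [set shift_idx A i | i in A].

Lemma shift_idxE (A : {set 'I_k}) i j : j \notin A -> down x y i j -> shift_idx A i = j.
Proof.
move=> jA d; rewrite /shift_idx; case: pickP => [j' /andP[_ d']|/(_ j)].
  exact: down_functional d' d.
by rewrite jA d.
Qed.

Lemma shift_idx_inj (A : {set 'I_k}) : {in A &, injective (shift_idx A)}.
Proof.
move=> i i' iA i'A; rewrite /shift_idx; case: pickP => [j /andP[jA d]|_].
  case: pickP => [j' /andP[j'A d'] e|_ e]; first by move: d'; rewrite -e; apply: down_injective d.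
  by rewrite e i'A in jA.
by case: pickP => [j' /andP[j'A d'] e|_ //]; rewrite -e iA in j'A.
Qed.

Lemma card_shift (A : {set 'I_k}) : #|shift A| = #|A|.
Proof. exact: card_in_imset (@shift_idx_inj A). Qed.

Lemma sum_shift_lt (A : {set 'I_k}) i j : i \in A -> j \notin A -> down x y i j ->
  (\sum_(i in shift A) sm i < \sum_(i in A) sm i)%N.
Proof.
move=> iA jA d; rewrite big_imset //=; last exact: shift_idx_inj.
rewrite (bigD1 i) //= [X in (_ < X)%N](bigD1 i) //= (shift_idxE jA d) -addSn.
apply: leq_add; first by have := down_sm d; rewrite xy; lia.
apply: leq_sum => i' _; rewrite /shift_idx; case: pickP => // j' /andP[_ /down_sm].
rewrite xy; lia.
Qed.

(* The limit of the coordinate subspace of A under the shears shear_mx t^-1, t -> 0, is the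
   coordinate subspace of the combinatorial shift of A. *)
Lemma shift_limit (A : {set 'I_k}) N :
  (\dim (coord_tens (E := E) A N.+1) <= \dim (coord_tens (E := E) (shift A) N.+1))%N.
Proof.
pose P j := [exists i in A, down x y i j].
(* For [j] outside [A] the sheared equation is [p_j + t^-1 p_i = 0] with [i] above [j]. If [i] is in
   [A], it is multiplied by [t] and becomes [p_i = 0] at [t = 0]. If [i] is outside [A], then
   [p_i = 0] is itself an equation and [p_j = 0] remains. *)
pose Mt : 'M[{poly E}]_k := \matrix_(i, j) (if j \in A then 0
  else if P j then 'X * (i == j)%:R + (down x y i j)%:R else (i == j)%:R).
have MtE c i j : map_mx (horner_eval c) Mt i j = if j \in A then 0
  else if P j then c * (i == j)%:R + (down x y i j)%:R else (i == j)%:R.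
  rewrite !mxE /horner_eval; case: ifP => _; first by rewrite horner0.
  by case: ifP => _; rewrite ?hornerD ?hornerM ?hornerX -?polyC_natr !hornerC.
have delta (F : 'I_k -> E) j : \sum_i (i == j)%:R * F i = F j.
  by rewrite (bigD1 j) //= eqxx mul1r big1 ?addr0 // => i /negPf ->; rewrite mul0r.
apply: leq_trans (_ : _ <= \dim (section_tens (map_mx (horner_eval 0) Mt) N))%N _; last first.
  apply/dimvS/subvP => z /section_tensP[zD z0]; apply/coord_tens1P; split=> // i t iS.
  (* An index missing from the shift either was in [A] and moved to some [j], and the column of [j]
     kills it, or was outside [A] with nothing moving onto it, and its own column does. *)
  have [iA|iA] := boolP (i \in A).
    have : shift_idx A i != i.
      by apply: contraNneq iS => e; rewrite -e; apply: imset_f.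
    rewrite /shift_idx; case: pickP => [j /andP[jA d] _|]; last by rewrite eqxx.
    have Pj : P j by apply/existsP; exists i; rewrite iA.
    rewrite -(z0 j t); under eq_bigr do rewrite MtE (negPf jA) Pj mul0r add0r.
    by rewrite (sum_down _ d).
  have nP : P i = false.
    apply: contraNF iS => /existsP[i' /andP[i'A d]]; apply/imsetP; exists i' => //.
    by rewrite (shift_idxE iA d).
  by rewrite -(z0 i t); under eq_bigr do rewrite MtE (negPf iA) nP; rewrite delta.
apply: section_semicont => c c0; rewrite -coord_mx_tens.
have := section_tens_act (shear_mx c^-1 *m coord_mx A) N (@shear_stable (- c^-1)) (shear_mxV c^-1).
rewrite mulmxA shear_mxV mul1mx => /leq_trans; apply; apply/dimvS/subvP.
move=> z /section_tensP[zD z0]; apply/section_tensP; split=> // j t.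
have zE j' : j' \notin A ->
    z (cons_tuple j' t) + c^-1 * \sum_i (down x y i j')%:R * z (cons_tuple i t) = 0.
  move=> j'A; rewrite -[RHS](z0 j' t).
  have GE i : (shear_mx c^-1 *m coord_mx A) i j' = (i == j')%:R + c^-1 * (down x y i j')%:R.
    rewrite mxE (bigD1 j') //= big1 ?addr0 => [|i' /negPf ne]; last by rewrite !mxE ne mulr0.
    by rewrite !mxE eqxx j'A mulr1.
  under [RHS]eq_bigr do rewrite GE mulrDl -mulrA.
  by rewrite big_split /= delta -mulr_sumr.
have [jA|jA] := boolP (j \in A).
  by rewrite big1 // => i _; rewrite MtE jA mul0r.
under eq_bigr do rewrite MtE (negPf jA).
case: (boolP (P j)) => [_|nP].
  under eq_bigr do rewrite mulrDl -mulrA; rewrite big_split /= -mulr_sumr delta.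
  have := congr1 ( *%R c) (zE j jA); rewrite mulr0 mulrDr mulrA divff // mul1r.
  by [].
rewrite delta; have := zE j jA; rewrite big1 ?mulr0 ?addr0 // => i _.
case: (boolP (down x y i j)) => d; last by rewrite mul0r.
(* The equation at [i] has no second term: [i] does not contain [x], so no index goes down to
   [i]. *)
have iA : i \notin A by apply: contra nP => iA; apply/existsP; exists i; rewrite iA.
have := zE i iA; rewrite big1 ?mulr0 ?addr0 => [->|i' _]; first by rewrite mulr0.
case: (boolP (down x y i' i)) => [/downP[a [_ ia _]]|_]; last by rewrite mul0r.
by case: (down_notin xy_neq d ia).
Qed.

End ShiftLimit.

(** Each effective shift strictly lowers the total index sum, so the process stops at a shift-closed
    set. *)
Lemma downset_limit (E : closedFieldType) (l m : nat) (A : {set 'I_('C(m, l))}) :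
  exists B : {set 'I_('C(m, l))}, [/\ #|B| = #|A|, downset B & forall N,
    (\dim (coord_tens (E := E) A N.+1) <= \dim (coord_tens (E := E) B N.+1))%N].
Proof.
have [n] := ubnP (\sum_(i in A) sm i)%N; elim: n A => // n IH A; rewrite ltnS => An.
case: (classic (shift_closed A)) => [/shift_closed_downset dA|nsA]; first by exists A.
have [x [y [i [j [xy d iA jA]]]]] : exists (x y : 'I_m) (i j : 'I_('C(m, l))),
    [/\ y = x.+1 :> nat, down x y i j, i \in A & j \notin A].
  apply: NNPP => h; apply: nsA => x y i j xy d iA.
  by apply: contraT => jA; case: h; exists x, y, i, j.
have [|B [cB dB hB]] := IH (shift x y A).
  exact: leq_trans (sum_shift_lt xy iA jA d) An.
exists B; split=> //; first by rewrite cB card_shift.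
by move=> N; apply: leq_trans (hB N); apply: shift_limit.
Qed.

Lemma leq_exp2rW p q e : (p <= q -> p ^ e <= q ^ e)%N.
Proof. by case: e => // e; rewrite leq_exp2r. Qed.

(** * Growth for down-sets *)

Section Growth.
Variables (E : fieldType) (l m : nat).
Local Notation k := 'C(m, l).
Implicit Types (A : {set 'I_k}) (b c i j : 'I_k).

Definition hilb A N := \dim (coord_tens (E := E) A N).

Fixpoint slices b n N : 'Hom(tens E k (n + N), tens E k N) :=
  if n is n'.+1 then (slices b n' N \o tslice b (n' + N))%VF else \1%VF.

Lemma slicesE b n N (x : tens E k (n + N)) t :
  slices b n N x t = x (cat_tuple (nseq_tuple n b) t).
Proof.
elim: n x => [|n IH] x /=; first by rewrite id_lfunE; congr (x _); apply: val_inj.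
by rewrite comp_lfunE IH tsliceE; congr (x _); apply: val_inj.
Qed.

Lemma slice_coord A b N x : x \in coord_tens A N.+1 -> tslice b N x \in coord_tens (E := E) A N.
Proof.
move=> /coord_tensP[xD x0]; apply/coord_tensP; split; first exact: veronese_slice.
by move=> t ht; rewrite tsliceE x0 //= ht orbT.
Qed.

Lemma slices_coord A b n N x :
  x \in coord_tens A (n + N) -> slices b n N x \in coord_tens (E := E) A N.
Proof.
elim: n x => [|n IH] x /=; first by rewrite id_lfunE.
by move=> xA; rewrite comp_lfunE; apply: IH; apply: slice_coord.
Qed.

(** The tensors lost by one slice at [b] vanish when the first slot is [b], hence by symmetry are
    supported off [b]; rank-nullity is iterated [n] times. *)
Lemma slices_dim A b n N (V : {vspace tens E k (n + N)}) : (V <= coord_tens A (n + N))%VS ->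
  (\dim V <= \sum_(j < n) hilb (A :\ b) (j.+1 + N) + \dim (slices b n N @: V))%N.
Proof.
elim: n V => [|n IH] V VA /=.
  rewrite big_ord0; apply: leq_trans (leq_addl _ _); apply: dimvS; apply/subvP => x xV.
  by rewrite -[x]id_lfunE memv_img.
rewrite big_ord_recr /= [X in (_ <= X)%N]addnAC.
rewrite -(limg_ker_dim (tslice b (n + N)) V) [X in (X <= _)%N]addnC limg_comp; apply: leq_add.
  apply: IH; apply/subvP => _ /memv_imgP[x xV ->]; apply: slice_coord; exact: (subvP VA).
apply/dimvS/subvP => x; rewrite memv_cap memv_ker => /andP[/(subvP VA)/coord_tens1P[xD x0] /eqP xb].
apply/coord_tens1P; split=> // i t; rewrite !inE negb_and negbK => /orP[/eqP ->|/x0 -> //].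
by rewrite -tsliceE xb ffunE.
Qed.

(* On the Grassmannian p_b^l p_c = p_b det(p_(b[i -> c_j])), and if c is not below b every term
   of the determinant contains a coordinate of larger index sum than b. *)
Lemma slices_down A b N x : (forall i, i \in A -> (sm i <= sm b)%N) ->
  x \in coord_tens A (l + N) -> slices b l N x \in coord_tens (E := E) [set i | bru i b] N.
Proof.
move=> bmax xA; have /coord_tensP[yD _] := slices_coord b xA.
case: N x xA yD => [|N] x xA yD.
  by apply/coord_tensP; split=> // t /hasP[i]; rewrite (tuple0 t).
apply/coord_tens1P; split=> // c t; rewrite inE => cb; rewrite slicesE.
have /fin_all_exists[e he] : forall p : 'I_l * 'I_l, exists ed : E * 'I_k,
   (forall W, minor W (exch b p.1 (ix c p.2)) = ed.1 * plucker W ord0 ed.2) /\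
   ((ix b p.1 < ix c p.2)%N -> ed.1 = 0 \/ (sm b < sm ed.2)%N).
  by move=> [a a']; have [e [i h]] := exch_minor E b a (ix c a'); exists (e, i).
(* The quadratic-type relation is carried to tensors: [w] encodes [p_b^l p_c] and [u s] encodes the
   term of the permutation [s], [p_b] times [l] exchanged coordinates, both followed by [t]. *)
pose uu (s : 'S_l) := b :: [tuple (e (a, s a)).2 | a < l] ++ t.
have su s : size (uu s) == (l + N.+1)%N by rewrite /= size_cat !size_tuple card_ord addnS.
pose u s := Tuple (su s).
pose co (s : 'S_l) : E := (-1) ^+ s * \prod_a (e (a, s a)).1.
pose w := cat_tuple (nseq_tuple l b) (cons_tuple c t).
have rel (z : tens E k (l + N.+1)) : z \in veronese (l + N.+1) -> z w = \sum_s co s * z (u s).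
  pose f := kop (fun (_ : unit) v => (v == w)%:R - \sum_s co s * (v == u s)%:R : E).
  have fE (y : tens E k (l + N.+1)) : f y tt = y w - \sum_s co s * y (u s).
    have delta v0 : \sum_v (v == v0)%:R * y v = y v0.
      by rewrite (bigD1 v0) //= eqxx mul1r big1 ?addr0 // => v /negPf ->; rewrite mul0r.
    rewrite kopE; under eq_bigr do rewrite mulrBl; rewrite sumrB delta; congr (_ - _).
    under eq_bigr do rewrite mulr_suml; rewrite exchange_big; apply: eq_bigr => s _ /=.
    by under eq_bigr do rewrite -mulrA; rewrite -mulr_sumr delta.
  move=> zD; suff /ffunP/(_ tt) : f z = 0 by rewrite fE ffunE => /eqP; rewrite subr_eq0 => /eqP.
  apply: cspan_ker zD => _ [_ [W ->] ->]; apply/ffunP => -[]; rewrite fE [RHS]ffunE.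
  rewrite ffunE /= big_cat big_nseq iter_mulr_1 big_cons /=.
  set pt := \prod_(i <- t) _; set p := plucker W.
  have uE s : co s * tpow (l + N.+1) p (u s) =
     p 0 b * ((-1) ^+ s * \prod_a minor W (exch b a (ix c (s a)))) * pt.
    rewrite ffunE /= big_cons big_cat /= big_map big_enum /= /co -/pt.
    under [in RHS]eq_bigr => a _ do rewrite (he (a, s a)).1.
    rewrite big_split /= -/p !mulrA; congr (_ * _ * _).
    by rewrite mulrC !mulrA.
  under eq_bigr do rewrite uE; rewrite -mulr_suml -mulr_sumr.
  apply/eqP; rewrite subr_eq0 mulrA; apply/eqP; congr (_ * _).
  (* The columns at [b] times their adjugate give the scalar matrix [p_b], whose determinant is
     [p_b^l]. *)
  transitivity (p 0 b * \det (\adj (colsub (ix b) W) *m colsub (ix c) W)).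
    rewrite det_mulmx mulrA !pluckerE; congr (_ * _).
    by rewrite -[X in X * _]/(\det (colsub (ix b) W)) -det_mulmx mul_mx_adj det_scalar.
  congr (_ * _); apply: eq_bigr => s _; congr (_ * _); apply: eq_bigr => a _.
  by rewrite -adj_mul_minor !mxE; apply: eq_bigr => a' _; rewrite !mxE.
have /coord_tensP[xD x0] := xA; rewrite -/w (rel _ xD) big1 // => s _.
have [a ha] := bru_pigeonhole s cb; case: ((he (a, s a)).2 ha) => /= h.
  by rewrite /co (bigD1 a) //= h mul0r mulr0 mul0r.
rewrite x0 ?mulr0 //; apply/hasP; exists (e (a, s a)).2.
  by rewrite /= inE mem_cat; apply/orP; right; apply/orP; left; apply/mapP; exists a; rewrite ?mem_enum.
by apply/negP => /bmax; rewrite leqNgt h.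
Qed.

Lemma hilb_step A b N : (hilb A N.+1 <= hilb (A :\ b) N.+1 + hilb A N)%N.
Proof.
have := slices_dim b (n := 1) (N := N) (subvv (coord_tens A N.+1)).
rewrite big_ord1 => /leq_trans; apply; rewrite leq_add2l.
apply/dimvS/subvP => _ /memv_imgP[x xA ->]; exact: slices_coord.
Qed.

Lemma hilb_down A b N : (forall i, i \in A -> (sm i <= sm b)%N) ->
  (hilb A (l + N) <= \sum_(j < l) hilb (A :\ b) (j.+1 + N) + hilb [set i | bru i b] N)%N.
Proof.
move=> bmax; apply: leq_trans (slices_dim b (subvv (coord_tens A (l + N)))) _.
rewrite leq_add2l; apply/dimvS/subvP => _ /memv_imgP[x xA ->]; exact: slices_down bmax xA.
Qed.

Lemma hilb0 N : hilb set0 N.+1 = 0%N.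
Proof.
apply/eqP; rewrite dimv_eq0 -subv0; apply/subvP => x /coord_tens1P[_ x0].
rewrite memv0; apply/eqP/ffunP => t; rewrite ffunE.
by case/tupleP: t => i t; rewrite x0 ?inE.
Qed.

(** The dimension of the Schubert variety. The subtraction never truncates, since entry [a] is at
    least [a]. *)
Definition rk i := (sm i - \sum_(a < l) a)%N.

Lemma rkE i : (rk i + \sum_(a < l) a = sm i)%N.
Proof. by rewrite subnK //; apply: leq_sum => a _; exact: ix_ge. Qed.

Lemma bru_rk i j : bru i j -> i != j -> (rk i < rk j)%N.
Proof. by move=> ij /(bru_sm ij); rewrite -!rkE ltn_add2r. Qed.

(** Induction on [#|A|], with [b] of maximal sum in [A], so that [A :\ b] is again a down-set. If
    [A] is all that lies below [b], the ranks in [A :\ b] are less than [r], and summing [hilb_step]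
    raises the exponent by one. Otherwise [A :\ b] and the indices below [b] are both smaller
    down-sets, and [hilb_down] applies. *)
Lemma hilb_growth A r : downset A -> (forall i, i \in A -> (rk i <= r)%N) ->
  exists C, forall N, (hilb A N <= C * N.+1 ^ r)%N.
Proof.
have [n] := ubnP #|A|; elim: n A r => // n IH A r; rewrite ltnS => An dA Ar.
have pos N r' : (0 < N.+1 ^ r')%N by rewrite expn_gt0.
have [->|[b0 b0A]] := set_0Vmem A.
  exists (hilb set0 0) => -[|N]; last by rewrite hilb0.
  by rewrite exp1n muln1.
have [b bA' bmax'] := @arg_maxnP _ b0 (mem A) (@sm l m) b0A.
have bA : b \in A := bA'.
have bmax i : i \in A -> (sm i <= sm b)%N by exact: bmax'.
have dAb : downset (A :\ b).
  move=> i j ji; rewrite !inE => /andP[ib iA]; rewrite (dA _ _ ji iA) andbT.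
  apply: contraNneq ib => jb; rewrite jb in ji; apply/eqP/esym/eqP; apply: contraT => ne.
  by have := bru_sm ji ne; rewrite ltnNge bmax.
have cAb : (#|A :\ b| < n)%N by apply: leq_trans An; rewrite (cardsD1 b A) bA.
have dnA : [set i | bru i b] \subset A by apply/subsetP => i; rewrite inE => /dA; apply.
have [eA|neA] := eqVneq A [set i | bru i b].
  have lt i : i \in A :\ b -> (rk i < r)%N.
    rewrite !inE => /andP[ib iA]; apply: leq_trans (Ar b bA); apply: bru_rk => //.
    by move: iA; rewrite eA inE.
  case: r Ar lt => [|r] Ar lt.
    exists (hilb A 0); elim=> [|N IHN]; first by rewrite expn0 muln1.
    have A0 : A :\ b = set0 by apply/setP => i; rewrite in_set0; apply/negP => /lt.
    by apply: leq_trans (hilb_step A b N) _; rewrite A0 hilb0.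
  have [C hC] := IH _ r cAb dAb lt.
  have H N : (hilb A N <= hilb A 0 + N * (C * N.+1 ^ r))%N.
    elim: N => [|N IHN]; first by rewrite leq_addr.
    apply: leq_trans (hilb_step A b N) _; rewrite mulSn addnCA; apply: leq_add; first exact: hC.
    apply: leq_trans IHN _; rewrite leq_add2l leq_mul2l; apply/orP; right.
    by rewrite leq_mul2l; apply/orP; right; apply: leq_exp2rW.
  exists (hilb A 0 + C)%N => N; apply: leq_trans (H N) _; rewrite mulnDl; apply: leq_add.
    exact: leq_pmulr.
  by rewrite expnS [X in (_ <= X)%N]mulnCA leq_mul2r leqnSn orbT.
have cdn : (#|[set i | bru i b]| < n)%N.
  by apply: leq_trans An; apply: proper_card; rewrite properEneq eq_sym neA.
have ddn : downset [set i | bru i b] by move=> i j; rewrite !inE; exact: bru_trans.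
have [|C1 h1] := IH _ r cdn ddn; first by move=> i /(subsetP dnA)/Ar.
have [|C2 h2] := IH _ r cAb dAb; first by move=> i /setD1P[_ /Ar].
(* The first summand covers the degrees below [l], where [hilb_down] says nothing. *)
exists (\sum_(j < l) hilb A j + l * C2 + C1)%N => N.
rewrite !mulnDl; have [lt|ge] := ltnP N l.
  rewrite -addnA; apply: leq_trans (leq_addr _ _); apply: leq_trans (leq_pmulr _ (pos _ _)).
  by rewrite (bigD1 (Ordinal lt)) //= leq_addr.
rewrite -(subnKC ge); set N' := (N - l)%N.
apply: leq_trans (hilb_down N' bmax) _; rewrite -addnA; apply: leq_trans (leq_addl _ _); apply: leq_add.
  apply: leq_trans (_ : _ <= \sum_(j < l) (C2 * (l + N').+1 ^ r))%N _; last first.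
    by rewrite sum_nat_const card_ord mulnA.
  apply: leq_sum => j _; apply: leq_trans (h2 _) _; rewrite leq_mul2l; apply/orP; right.
  by apply: leq_exp2rW; rewrite ltnS leq_add2r.
apply: leq_trans (h1 _) _; rewrite leq_mul2l; apply/orP; right.
by apply: leq_exp2rW; rewrite ltnS leq_addl.
Qed.

End Growth.

Lemma expn_le_ffact n r : (n.+1 ^ r <= (n + r) ^_ r)%N.
Proof.
elim: r => [|r IH]; first by rewrite ffactn0.
by rewrite addnS ffactSS expnS leq_mul // ltnS leq_addr.
Qed.

Lemma binomial_growth C D r : (0 < D)%N ->
  ~ (forall n, (0 < n)%N -> ('C(n + r.+1, r.+1) <= C * (n * D).+1 ^ r)%N).
Proof.
(* At [n = M + 1] the assumed bound, multiplied by [(r + 1)!], gives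
   [(M + 2)^(r + 1) <= M * (M + 2)^r]. *)
move=> D0 H; pose M := (r.+1`! * C * D.+1 ^ r)%N.
have := H M.+1 isT; rewrite -(leq_pmul2r (fact_gt0 r.+1)) bin_ffact => le.
have := leq_trans (expn_le_ffact M.+1 r.+1) le; rewrite leqNgt => /negP; apply.
rewrite [X in (_ < X)%N]expnS.
apply: leq_ltn_trans (_ : _ <= M * M.+2 ^ r)%N _; last by rewrite ltn_pmul2r ?expn_gt0 // ltnW.
have hX : ((M.+1 * D).+1 ^ r <= D.+1 ^ r * M.+2 ^ r)%N.
  by rewrite -expnMn; apply: leq_exp2rW; move: (M) => M'; nia.
apply: leq_trans (leq_mul (leq_mul (leqnn C) hX) (leqnn _)) _; apply: eq_leq.
move: (M.+2 ^ r)%N => b; rewrite /M; move: (r.+1)`! => f.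
by rewrite -!mulnA [RHS]mulnC -!mulnA.
Qed.

Lemma tpow_scale (E : fieldType) k N c (v : 'rV[E]_k) : tpow N (c *: v) = c ^+ N *: tpow N v.
Proof.
apply/ffunP => t; rewrite !ffunE /GRing.scale /=.
under eq_bigr do rewrite mxE.
by rewrite big_split /= big_const_seq count_predT size_tuple iter_mulr_1.
Qed.

(** * Bounding the length of a chain in a linear section *)

Section ChainBound.
Variables (E : closedFieldType) (l m : nat).
Local Notation k := 'C(m, l).

(** Powers of points of the top set lie in [section_tens (cokermx L)], whose dimension is bounded by
    the Hilbert function of the limiting down-set [B]. If all ranks in [B] were below [r], this
    would grow too slowly for the chain; for [r = 0], [B] would be empty. *)
Lemma section_chain_bound (L : 'M[E]_k) (C : pset E k) r :
    (forall v, C v -> grass v /\ (v <= L)%MS) -> (forall v, C v -> v != 0) ->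
    irred_chain C r ->
  exists A : {set 'I_k}, [/\ (#|A| <= \rank L)%N, downset A & exists2 i, i \in A & (r <= rk i)%N].
Proof.
move=> CL C0 [Z [irrZ ZZ]].
have [D D0 hD] := chain_dim C0 irrZ ZZ.
have [A [cA hA]] := torus_limit (cokermx L).
have [B [cB dB hB]] := downset_limit E A.
have bound n : (0 < n)%N -> ('C(n + r, r) <= hilb E B (n * D))%N.
  move=> n0; have := hD 1%N isT n; rewrite muln1 => /leq_trans; apply.
  have: (0 < n * D)%N by rewrite muln_gt0 n0.
  case: (n * D)%N => // N _.
  apply: leq_trans (hB N); apply: leq_trans (hA N); apply/dimvS/cspan_sub => _ [v Zv ->].
  have [_ [T _ ZT]] := irrZ r (leqnn r).
  have [[W [_ [c c0 vW]]] vL] : grass v /\ (v <= L)%MS by apply: CL; case/ZT: Zv.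
  apply/section_tensP; split=> [|q t].
    rewrite vW tpow_scale rpredZ //; apply: mem_cspan; exists (plucker W) => //.
    by exists W.
  have : (v *m cokermx L) 0 q = 0 by move: vL; rewrite submxE => /eqP ->; rewrite mxE.
  rewrite mxE => v0; under eq_bigr do rewrite ffunE big_cons mulrA.
  have v0' : \sum_a cokermx L a q * v 0 a = 0.
    by apply: etrans v0; apply: eq_bigr => a _; rewrite mulrC.
  by rewrite -mulr_suml v0' mul0r.
exists B; split=> //.
  rewrite cB; move: cA; rewrite mxrank_coker; have := rank_leq_row L; lia.
case: (classic (exists2 i, i \in B & (r <= rk i)%N)) => // nB.
have lt i : i \in B -> (rk i < r)%N by move=> iB; rewrite ltnNge; apply/negP => ?; apply: nB; exists i.
case: r {ZZ irrZ hD nB} bound lt => [|r] bound lt.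
  have B0 : B = set0 by apply/setP => i; rewrite in_set0; apply/negP => /lt.
  have := bound 1%N isT; rewrite B0 mul1n bin0; case: (D) D0 => // D' _.
  by rewrite hilb0.
have [c hc] := hilb_growth E dB lt.
case: (binomial_growth (C := c) (r := r) D0) => n n0.
exact: leq_trans (bound n n0) (hc _).
Qed.

End ChainBound.

(** * Schubert varieties *)

Section SchubertCell.
Variables (E : closedFieldType) (l m : nat).
Local Notation k := 'C(m, l).
Implicit Types (b c i : 'I_k) (W : 'M[E]_(l, m)).

Lemma colsub_mul (A : 'M[E]_l) W (f : 'I_l -> 'I_m) : colsub f (A *m W) = A *m colsub f W.
Proof. by apply/matrixP => i j; rewrite !mxE; apply: eq_bigr => h _; rewrite mxE. Qed.

Lemma plucker_mul (A : 'M[E]_l) W : plucker (A *m W) = \det A *: plucker W.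
Proof. by apply/rowP => i; rewrite !mxE colsub_mul det_mulmx. Qed.

Lemma row_free_minor W (f : 'I_l -> 'I_m) : minor W f != 0 -> row_free W.
Proof.
move=> h; have u : colsub f W \in unitmx by rewrite unitmxE unitfE.
have -> : W = W *m 1%:M by rewrite mulmx1.
rewrite mulmx1 -row_leq_rank -[X in (X <= _)%N](mxrank_unit u).
have -> : colsub f W = W *m colsub f 1%:M.
  apply/matrixP => a j; rewrite !mxE (bigD1 (f j)) //= !mxE eqxx mulr1 big1 ?addr0 // => z /negPf ne.
  by rewrite !mxE ne mulr0.
exact: mxrankM_maxl.
Qed.

Lemma plucker_neq0 W : row_free W -> exists i, plucker W 0 i != 0.
Proof.
move=> rf; have rf' : row_full W^T by rewrite -col_leq_rank mxrank_tr row_leq_rank.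
have u := fullrowsub_unit rf'.
set f := fullrankfun rf' in u.
have Wf : minor W f != 0.
  move: u; rewrite unitmxE unitfE -det_tr; congr (\det _ != 0).
  by apply/matrixP => i j; rewrite !mxE.
have finj : injective f.
  by apply: NNPP => h; move: Wf; rewrite minor_noninj ?eqxx.
have [i [s fs]] := ix_perm finj; exists i.
by apply: contraNneq Wf => e; rewrite (minor_perm _ fs) e mulr0.
Qed.

Lemma grass_neq0 (v : 'rV[E]_k) : grass v -> v != 0.
Proof.
move=> [W [rf [c c0 ->]]]; have [i hi] := plucker_neq0 rf.
by apply/rV0Pn; exists i; rewrite mxE mulf_neq0.
Qed.

(** Row [a] lies in the flag space named by entry [a] of [b]; for fixed [b] this is a linear
    condition on [W]. *)
Definition ech b W := forall a (j : 'I_m), (ix b a < j)%N -> W a j = 0.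

Lemma ech_plucker b c W : ech b W -> ~~ bru c b -> plucker W ord0 c = 0.
Proof.
move=> eW cb; rewrite pluckerE; apply: (det_bru0 cb) => a a' h.
by rewrite mxE; apply: eW.
Qed.

(** Take [b] of maximal sum with nonzero coordinate and normalise the columns at [b] to the
    identity. By Cramer's rule an entry to the right of [ix b a] is, up to sign, a coordinate of
    larger sum or zero, so it vanishes. *)
Lemma grass_normal (v : 'rV[E]_k) : grass v -> exists b W (z : E),
  [/\ z != 0, v = z *: plucker W, row_free W, ech b W & v 0 b != 0].
Proof.
move=> gv; have /rV0Pn[b0 vb0] := grass_neq0 gv; case: gv => W0 [rf0 [c0 c0n0 vW0]].
have [b vb' bmax'] := @arg_maxnP _ b0 (fun i => v 0 i != 0) (@sm l m) vb0.
have vb : v 0 b != 0 := vb'.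
have bmax i : (sm b < sm i)%N -> v 0 i = 0.
  by move=> lt; apply: contraTeq lt => /bmax'; rewrite -leqNgt.
have db : \det (colsub (ix b) W0) != 0.
  by move: vb; rewrite vW0 mxE pluckerE mulf_eq0 negb_or => /andP[].
have u : colsub (ix b) W0 \in unitmx by rewrite unitmxE unitfE.
pose W := invmx (colsub (ix b) W0) *m W0.
have W1 : colsub (ix b) W = 1%:M by rewrite colsub_mul mulVmx.
have vW : v = (c0 * \det (colsub (ix b) W0)) *: plucker W.
  by rewrite plucker_mul scalerA det_inv -mulrA divff // mulr1.
have cn0 : c0 * \det (colsub (ix b) W0) != 0 by rewrite mulf_neq0.
exists b, W, (c0 * \det (colsub (ix b) W0)); split=> //.
  by apply: (@row_free_minor _ (ix b)); rewrite /minor W1 det1 oner_eq0.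
move=> a j baj; have := adj_mul_minor W b a j.
rewrite W1 adj1 mul1mx => ->.
have [e [i [-> /(_ baj)]]] := exch_minor E b a j.
case=> [->|/bmax]; first by rewrite mul0r.
by rewrite vW mxE => /eqP; rewrite mulf_eq0 (negPf cn0) => /eqP ->; rewrite mulr0.
Qed.

(** Coordinate equations make closedness immediate; [schubert_varP] recovers the description by
    echelon matrices, which gives irreducibility. *)
Definition schubert_var b : pset E k :=
  fun v => grass v /\ forall c, ~~ bru c b -> v 0 c = 0.

Lemma schubert_varP b v : schubert_var b v <->
  exists W (z : E), [/\ z != 0, v = z *: plucker W, row_free W & ech b W].
Proof.
split=> [[gv v0]|[W [c [c0 -> rf eW]]]].
  have [b' [W [c [c0 vW rf eW vb']]]] := grass_normal gv.
  exists W, c; split=> // a j h; apply: eW; apply: leq_ltn_trans h.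
  apply: (bruP b' b); apply: contraT => /v0 e; by rewrite e eqxx in vb'.
split; first by exists W; split=> //; exists c.
by move=> c' cb; rewrite mxE (ech_plucker eW cb) mulr0.
Qed.

Definition coord_pt b : 'M[E]_(l, m) := \matrix_(a, j) (j == ix b a)%:R.

Lemma colsub_coord_pt b : colsub (ix b) (coord_pt b) = 1%:M.
Proof. by apply/matrixP => a a'; rewrite !mxE (inj_eq (@ix_strict_inj l m b)) eq_sym. Qed.

Lemma coord_pt_free b : row_free (coord_pt b).
Proof. by apply: (@row_free_minor _ (ix b)); rewrite /minor colsub_coord_pt det1 oner_eq0. Qed.

Lemma plucker_coord_pt b i : plucker (coord_pt b) ord0 i = (i == b)%:R.
Proof.
rewrite pluckerE; have [->|ne] := eqVneq i b; first by rewrite /minor colsub_coord_pt det1.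
have [/existsP[a /forallP ha]|h] := boolP [exists a, [forall a', ix i a' != ix b a]].
  rewrite /minor (expand_det_row _ a) big1 // => a' _.
  by rewrite !mxE (negPf (ha a')) mul0r.
have sub : {subset codom (ix b) <= codom (ix i)}.
  move=> _ /codomP[a ->]; apply: contraR h => nc; apply/existsP; exists a; apply/forallP => a'.
  by apply: contra nc => /eqP <-; exact: codom_f.
have U (j : 'I_k) : uniq (codom (ix j)) by rewrite map_inj_uniq ?enum_uniq //; exact: ix_strict_inj.
have [|_ eqm] := uniq_min_size (U b) sub; first by rewrite !size_codom.
case/eqP: ne; apply: wt_inj; rewrite !wtE; apply: eq_bigr => x _; by rewrite eqm.
Qed.

Lemma coord_pt_schubert_var b : schubert_var b (plucker (coord_pt b)).
Proof.
split; first by exists (coord_pt b); split; [exact: coord_pt_free | exists 1; rewrite ?oner_eq0 ?scale1r].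
move=> c cb; rewrite plucker_coord_pt; case: eqP => // e; by rewrite e bru_refl in cb.
Qed.

Lemma form_at_scale d (phi : d.-tuple 'I_k -> E) z v :
  form_at phi (z *: v) = z ^+ d * form_at phi v.
Proof.
rewrite /form_at mulr_sumr; apply: eq_bigr => u _.
by rewrite tpow_scale [in LHS]ffunE mulrCA.
Qed.

Lemma not_zclosed_form (T : pset E k) v : zclosed T -> v != 0 -> ~ T v ->
  exists d (phi : d.-tuple 'I_k -> E), form_at phi v != 0 /\ forall u, T u -> form_at phi u = 0.
Proof.
move=> [P [Ph hT]] v0 nT; have nP : ~ forall p, P p -> p.@[v ord0] = 0.
  by move=> h; apply: nT; apply/hT.
have [p Hp] := not_all_ex_not _ _ nP; have [Pp pv] := imply_to_and _ _ Hp.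
have [d /form_of_mpoly[phi hphi]] := Ph p Pp.
exists d, phi; split=> [|u /hT[_ /(_ p Pp)]]; first by rewrite -hphi; apply/eqP.
by rewrite hphi.
Qed.

(* The echelon matrices form a linear space, so two points are joined by a line of such matrices. *)
Lemma schubert_var_irreducible b : irreducible (schubert_var b).
Proof.
split; first by exists (plucker (coord_pt b)); exact: coord_pt_schubert_var.
move=> T1 T2 cl1 cl2 cover; apply: NNPP => /not_or_and[n1 n2].
have key T : zclosed T -> ~ psub (schubert_var b) T -> exists W d (phi : d.-tuple 'I_k -> E),
    [/\ row_free W, ech b W, form_at phi (plucker W) != 0 & forall u, T u -> form_at phi u = 0].
  move=> cl nT; have [v Hv] := not_all_ex_not _ _ nT; have [Yv nTv] := imply_to_and _ _ Hv.
  have [d [phi [phiv phiT]]] := not_zclosed_form cl (grass_neq0 (proj1 Yv)) nTv.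
  have /schubert_varP[W [c [c0 vW rf eW]]] := Yv.
  exists W, d, phi; split=> //; apply: contraNneq phiv => e.
  by rewrite vW form_at_scale e mulr0.
have [W1 [d1 [phi1 [rf1 e1 p1 T1p]]]] := key T1 cl1 n1.
have [W2 [d2 [phi2 [rf2 e2 p2 T2p]]]] := key T2 cl2 n2.
have [i0 hi0] := plucker_neq0 rf1.
pose Wt : 'M[{poly E}]_(l, m) := \matrix_(a, j) ((W1 a j)%:P + 'X * (W2 a j - W1 a j)%:P).
pose Ws s : 'M[E]_(l, m) := \matrix_(a, j) (W1 a j + s * (W2 a j - W1 a j)).
pose pt i := \det (colsub (ix i) Wt).
have ptE s i : (pt i).[s] = plucker (Ws s) ord0 i.
  rewrite det_horner pluckerE; congr (\det _); apply/matrixP => a a'.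
  by rewrite !mxE hornerD hornerM !hornerC hornerX.
pose Ft d (phi : d.-tuple 'I_k -> E) : {poly E} := \sum_u (phi u)%:P * \prod_(i <- tval u) pt i.
have FtE d (phi : d.-tuple 'I_k -> E) s : (Ft d phi).[s] = form_at phi (plucker (Ws s)).
  rewrite horner_sum; apply: eq_bigr => u _; rewrite hornerM hornerC ffunE horner_prod.
  by congr (_ * _); apply: eq_bigr => i _; rewrite ptE.
have Ws0 : Ws 0 = W1 by apply/matrixP => a j; rewrite mxE mul0r addr0.
have Ws1 : Ws 1 = W2 by apply/matrixP => a j; rewrite mxE mul1r addrC subrK.
have nz (p : {poly E}) s : p.[s] != 0 -> p != 0.
  by apply: contraNneq => ->; rewrite horner0.
(* A parameter [s] on the line where both forms are nonzero and the minor [i0] keeps full rank: a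
   point of the variety outside [T1] and [T2]. *)
have /closed_nonrootP[s] : Ft d1 phi1 * Ft d2 phi2 * pt i0 != 0.
  rewrite !mulf_neq0 //; first by apply: (nz _ 0); rewrite FtE Ws0.
    by apply: (nz _ 1); rewrite FtE Ws1.
  by apply: (nz _ 0); rewrite ptE Ws0.
rewrite !rootM !negb_or /root !FtE ptE => /andP[/andP[s1 s2] s3].
have : schubert_var b (plucker (Ws s)).
  apply/schubert_varP; exists (Ws s), 1; split; rewrite ?oner_eq0 ?scale1r //.
    by apply: (@row_free_minor _ (ix i0)); rewrite -pluckerE.
  by move=> a j h; rewrite mxE e1 // e2 // subrr mulr0 addr0.
by case/cover => [/T1p e|/T2p e]; [rewrite e eqxx in s1 | rewrite e eqxx in s2].
Qed.

Lemma schubert_var_closed b (C : pset E k) :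
  (forall v, C v -> grass v) -> psub (schubert_var b) C -> closed_in C (schubert_var b).
Proof.
move=> Cg YC; exists (fun v : 'rV[E]_k => v != 0 /\ forall c, ~~ bru c b -> v 0 c = 0).
  exists (fun p => exists2 c, ~~ bru c b & p = 'X_c); split=> [_ [c _ ->]|v].
    by exists 1%N; rewrite dhomogX /= mdeg1.
  split=> -[v0 h]; split=> //.
    by move=> _ [c cb ->]; rewrite mevalXU h.
  by move=> c cb; rewrite -(h 'X_c) ?mevalXU //; exists c.
move=> v; split=> [Yv|[/Cg gv [_ h]]]; last by split.
by split; [exact: YC | split; [exact: grass_neq0 (proj1 Yv) | exact: (proj2 Yv)]].
Qed.

Lemma schubert_var_sub b c : bru b c -> psub (schubert_var b) (schubert_var c).
Proof.
move=> bc v [gv h]; split=> // i ic; apply: h.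
by apply: contra ic => /bru_trans; apply.
Qed.

Lemma schubert_var_proper b c : bru b c -> b != c -> pproper (schubert_var b) (schubert_var c).
Proof.
move=> bc ne; split; first exact: schubert_var_sub.
move=> /(_ _ (coord_pt_schubert_var c))[_ /(_ c)]; rewrite plucker_coord_pt eqxx => h.
have cb : ~~ bru c b.
  by apply/negP => cb; have := bru_sm cb; rewrite eq_sym ne => /(_ isT); have := bru_sm bc ne; lia.
by have /eqP := h cb; rewrite oner_eq0.
Qed.

End SchubertCell.

(** * Enlarging down-sets and saturated chains of indices *)

Section Downsets.
Variables (l m : nat).
Local Notation k := 'C(m, l).

(** Add an index of minimal sum outside [A]: everything strictly below it has smaller sum and is
    already in [A]. *)
Lemma downset_extend (A : {set 'I_k}) K : downset A -> (#|A| <= K <= k)%N ->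
  exists B : {set 'I_k}, [/\ A \subset B, downset B & #|B| = K].
Proof.
have [n] := ubnP (K - #|A|); elim: n A => // n IH A; rewrite ltnS => Kn dA /andP[AK Kk].
have [e|ne] := eqVneq #|A| K; first by exists A.
have lt : (#|A| < K)%N by rewrite ltn_neqAle ne.
have [c0 c0A] : exists c, c \in ~: A.
  apply/set0Pn; rewrite -card_gt0 cardsCs setCK card_ord subn_gt0; exact: leq_trans lt Kk.
have [c cA' cmin] := @arg_minnP _ c0 (mem (~: A)) (@sm l m) c0A.
have cA : c \notin A by have : c \in ~: A := cA'; rewrite inE.
have card1 : #|c |: A| = #|A|.+1 by rewrite cardsU1 cA.
have [|||B [AB dB cB]] := IH (c |: A).
- by rewrite card1; lia.
- move=> i j ji; rewrite !inE => /orP[/eqP ic|iA]; last by rewrite (dA _ _ ji iA) orbT.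
  have [//|jc] := eqVneq j c; apply: contraT => jA.
  rewrite ic in ji; have := bru_sm ji jc; rewrite ltnNge; case/negP; apply: cmin.
  by rewrite /= inE.
- by rewrite card1 lt.
by exists B; split=> //; apply: subset_trans AB; exact: subsetUr.
Qed.

Hypothesis lm : (l <= m)%N.

Lemma bottom_exists : exists i0 : 'I_k, forall i, bru i0 i.
Proof.
have [|i0 h] := @ix_surj l m (widen_ord lm); first by [].
by exists i0 => i; apply/bruP => a; rewrite h; exact: ix_ge.
Qed.

Lemma rk_chain (b : 'I_k) : exists f : nat -> 'I_k, f (rk b) = b /\
  (forall i, (i < rk b)%N -> bru (f i) (f i.+1) && (f i != f i.+1)) /\
  (forall i, (i <= rk b)%N -> bru (f i) b).
Proof.
have [n] := ubnP (rk b); elim: n b => // n IH b; rewrite ltnS => bn.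
have [i0 hi0] := bottom_exists.
have [e|ne] := eqVneq i0 b.
  have b0 : rk b = 0%N.
    apply/eqP; rewrite -leqn0 leq_subLR addn0 -e.
    apply: leq_sum => a _; have [|c hc] := @ix_surj l m (widen_ord lm); first by [].
    by have := bruP _ _ (hi0 c) a; rewrite hc.
  by exists (fun=> b); rewrite b0; split=> //; split=> // i _; exact: bru_refl.
have [x [y [c [xy d _]]]] := lower_step (hi0 b) ne.
have rkb : rk b = (rk c).+1.
  by apply/eqP; rewrite -(eqn_add2r (\sum_(a < l) a)) addSn !rkE; have := down_sm d; rewrite xy; lia.
have cb : bru c b.
  apply/bruP => a; case/downP: d => a0 [ba ca h].
  by have [->|/h ->] := eqVneq a a0; first by rewrite ba ca xy.
have [|f [fc [hf hb]]] := IH c; first by rewrite -rkb.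
exists (fun i => if (i <= rk c)%N then f i else b); rewrite rkb ltnn; split=> //; split=> i.
  2: by case: (leqP i (rk c)) => [/hb ic _|_ _]; [exact: bru_trans cb | exact: bru_refl].
rewrite ltnS => ic; rewrite ic; case: ltnP => [lt|ge]; first exact: hf.
have -> : i = rk c by apply/eqP; rewrite eqn_leq ic.
rewrite fc cb /=; apply/eqP => e; move: rkb; rewrite e; lia.
Qed.

End Downsets.

(** * Sections by the coordinate spaces of down-sets *)

Section CoordSection.
Variables (F : fieldType) (E : closedFieldType) (iota : {rmorphism F -> E}) (l m : nat).
Local Notation k := 'C(m, l).

Lemma mul_pidE n p q (M : 'M[E]_(n, p)) i (j : 'I_p) :
  (M *m pid_mx q) i j = M i j * (j < q)%:R.
Proof.
rewrite mxE (bigD1 j) //= !mxE eqxx big1 ?addr0 // => a /negPf ne.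
by rewrite !mxE (_ : (a == j :> nat) = false) ?mulr0.
Qed.

(** Suppose the minor at [j] is nonzero and [ix i a < ix j a]. Taking the columns at [j] is then
    injective on the row space of [W], but on its intersection with the flag space only the first
    [a] of these columns can be nonzero; the rank is at most [a]. *)
Lemma schubert_plucker0 (W : 'M[E]_(l, m)) (i j : 'I_k) :
  (forall a : 'I_l, (a.+1 <= \rank (W :&: flag E m (ix i a).+1)%MS)%N) ->
  ~~ bru j i -> plucker W ord0 j = 0.
Proof.
move=> hW; rewrite negb_forall => /existsP[a]; rewrite -ltnNge => lt.
rewrite pluckerE; apply: contraTeq (hW a) => Wj.
have u : colsub (ix j) W \in unitmx by rewrite unitmxE unitfE.
set U := (W :&: _)%MS; rewrite -ltnNge ltnS.
have /submxP[Y UY] : (U <= W)%MS by apply: capmxSl.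
have /submxP[D UD] : (U <= flag E m (ix i a).+1)%MS by apply: capmxSr.
have U0 r (a' : 'I_l) : (a <= a')%N -> U r (ix j a') = 0.
  move=> aa'; rewrite UD mul_pidE ltnNge (leq_trans lt) ?ix_le //; exact: mulr0.
have NE : colsub (ix j) U = Y *m colsub (ix j) W.
  by rewrite UY; apply/matrixP => r c; rewrite !mxE; apply: eq_bigr => h _; rewrite mxE.
have rU : (\rank U <= \rank Y)%N by rewrite UY mxrankM_maxl.
apply: leq_trans rU _.
rewrite -(mxrankMfree Y (B := colsub (ix j) W)) ?row_free_unit // -NE.
have -> : colsub (ix j) U = colsub (ix j) U *m (pid_mx a : 'M_l).
  apply/matrixP => r c; rewrite mul_pidE; case: ltnP => [_|ge]; first by rewrite mulr1.
  by rewrite mulr0 mxE U0.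
apply: leq_trans (mxrankM_maxr _ _) _.
by rewrite rank_pid_mx // ltnW.
Qed.

Lemma coord_pt_schubert (b : 'I_k) : schubert (coord_idx b) (plucker (coord_pt E b)).
Proof.
exists (coord_pt E b) => [|a].
  by split; [exact: coord_pt_free | exists 1; rewrite ?oner_eq0 ?scale1r].
have <- : \rank ((pid_mx a.+1 : 'M_l) *m coord_pt E b) = a.+1.
  by rewrite mxrankMfree ?coord_pt_free // rank_pid_mx.
apply: mxrankS; rewrite sub_capmx submxMl /=.
set P := _ *m coord_pt E b; suff -> : P = P *m flag E m (ix b a).+1 by exact: submxMl.
apply/matrixP => r x; rewrite mul_pidE.
have PE : P r x = (r < a.+1)%:R * (x == ix b r)%:R.
  rewrite mxE (bigD1 r) //= !mxE eqxx big1 ?addr0 // => r' ne.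
  by rewrite !mxE (_ : (r == r' :> nat) = false) ?mul0r //; apply/negbTE; rewrite eq_sym.
rewrite PE; case: (leqP r.+1 a.+1) => ra; last by rewrite !mul0r.
case: eqP => [->|_]; last by rewrite mulr0 mul0r.
by rewrite ltnS ix_le // !mulr1.
Qed.

Definition coord_rows (A : {set 'I_k}) : 'M[F]_(#|A|, k) := \matrix_(r, j) (j == enum_val r)%:R.

Definition coord_space (A : {set 'I_k}) : 'M[F]_k := <<coord_rows A>>%MS.

Lemma rank_coord_space A : \rank (coord_space A) = #|A|.
Proof.
rewrite /coord_space genmxE; apply/eqP; apply/row_freeP; exists (coord_rows A)^T.
apply/matrixP => r s; rewrite !mxE (bigD1 (enum_val r)) //= !mxE eqxx mul1r big1 ?addr0.
  by rewrite (inj_eq enum_val_inj).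
by move=> j /negPf ne; rewrite !mxE ne mul0r.
Qed.

Lemma sub_coord_space A (v : 'rV[E]_k) :
  (v <= map_mx iota (coord_space A))%MS <-> forall j, j \notin A -> v 0 j = 0.
Proof.
rewrite /coord_space map_genmx genmxE; split=> [/submxP[D ->] j jA|v0].
  rewrite mxE big1 // => r _; rewrite !mxE; case: eqP => [e|_]; last by rewrite rmorph0 mulr0.
  by rewrite e enum_valP in jA.
apply/submxP; exists (\row_r v 0 (enum_val r)); apply/rowP => j; rewrite mxE.
have [jA|/[dup] jA /v0 ->] := boolP (j \in A); last first.
  rewrite big1 // => r _; rewrite !mxE; case: eqP => [e|_]; last by rewrite rmorph0 mulr0.
  by rewrite e enum_valP in jA.
rewrite (bigD1 (enum_rank_in jA j)) //= !mxE enum_rankK_in // eqxx rmorph1 mulr1 big1 ?addr0 //.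
move=> r ne; rewrite !mxE; case: eqP => [e|_]; last by rewrite rmorph0 mulr0.
by case/eqP: ne; apply: enum_val_inj; rewrite enum_rankK_in // -e.
Qed.

(** The union of the Schubert cycles of [A] lies in the coordinate space because [A] is a down-set,
    and it contains the coordinate points that span it. *)
Lemma coord_space_spanned A : downset A -> schubert_spanned iota (coord_space A).
Proof.
move=> dA; exists [set coord_idx i | i in A]; split.
  move=> v [_ /imsetP[i iA ->] [W [rf [c c0 ->]] hW]]; apply/sub_coord_space => j jA.
  rewrite mxE (@schubert_plucker0 W i) ?mulr0 //.
  by apply: contra jA => /dA; apply.
move=> L' hL'; rewrite /coord_space map_genmx genmxE; apply/row_subP => r.
rewrite (_ : row r _ = plucker (coord_pt E (enum_val r))).
  apply: hL'; exists (coord_idx (enum_val r)); last exact: coord_pt_schubert.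
  by apply: imset_f; exact: enum_valP.
by apply/rowP => j; rewrite plucker_coord_pt !mxE rmorph_nat.
Qed.

Lemma lin_section_coordP A v : lin_section iota (coord_space A) v <->
  grass v /\ forall j, j \notin A -> v 0 j = 0.
Proof. by split=> -[gv /sub_coord_space h]. Qed.

Lemma schubert_var_component A b d : (l <= m)%N -> downset A -> b \in A -> rk b = d ->
  (forall C r, (forall v, C v -> lin_section iota (coord_space A) v) -> irred_chain C r ->
     (r <= d)%N) ->
  has_component_dim iota (coord_space A) d.
Proof.
move=> lm dA bA bd bound.
have sub : psub (schubert_var b) (lin_section iota (coord_space A)).
  move=> v [gv h]; apply/lin_section_coordP; split=> // j jA; apply: h.
  by apply: contra jA => /dA; apply.
exists (schubert_var b).
  split=> //; first exact: schubert_var_irreducible.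
  move=> Z irrZ ZS YZ; apply: NNPP => nZY.
  have Zg v : Z v -> grass v by case/ZS.
  have [f [fb [hf fle]]] := rk_chain lm b.
  (* If [Z] were larger, the chain of Schubert varieties up to [b], with [Z] put on top, would have
     length [d + 1] in [Z]. *)
  have := bound Z d.+1 ZS; rewrite ltnn => /(_ _) h; suff : false by [].
  apply: h; exists (fun i => if (i <= d)%N then schubert_var (f i) else Z); split=> i.
    case: (leqP i d) => [id _|di _].
      split; first exact: schubert_var_irreducible.
      apply: schubert_var_closed => // v /(schubert_var_sub (fle i _)) /YZ; apply.
      by rewrite bd.
    split=> //; exists (fun v => v != 0).
      by exists (fun=> False); split=> // v; split=> [v0|[]].
    by move=> v; split=> [Zv|[]] //; split=> //; exact: grass_neq0 (Zg v Zv).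
  rewrite ltnS => id; rewrite id; case: (ltnP i d) => [lt|di].
    by have := hf i; rewrite bd lt => /(_ isT)/andP[? ?]; exact: schubert_var_proper.
  have -> : i = rk b by rewrite bd; apply/eqP; rewrite eqn_leq id.
  by rewrite fb.
split.
  have [f [fb [hf fle]]] := rk_chain lm b.
  exists (fun i => schubert_var (f i)); split=> i id.
    split; first exact: schubert_var_irreducible.
    apply: schubert_var_closed; first by move=> v [].
    by apply/schubert_var_sub/fle; rewrite bd.
  by have := hf i; rewrite bd id => /(_ isT)/andP[? ?]; exact: schubert_var_proper.
move=> r; apply: bound => v Yv; exact: sub.
Qed.

End CoordSection.

Theorem mainTheorem15 (F : fieldType) (Fbar : closedFieldType)
    (iota : {rmorphism F -> Fbar})
    (Falg : forall x : Fbar, algebraicOver iota x)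
    (l m K : nat) (hl : (1 <= l)%N) (hlm : (l < m)%N)
    (hK : (1 <= K)%N) (hKk : (K <= 'C(m, l))%N) :
  exists d : nat,
    is_max (fun r => exists2 L : 'M[F]_('C(m, l)),
              \rank L = K & has_component_dim iota L r) d /\
    is_max (fun r => exists L : 'M[F]_('C(m, l)),
              [/\ \rank L = K, schubert_spanned iota L
                & has_component_dim iota L r]) d.
Proof.
pose I := 'I_('C(m, l)).
pose ds (A : {set I}) := [forall i, forall j, bru j i ==> (i \in A) ==> (j \in A)].
have dsP A : reflect (downset A) (ds A).
  apply: (iffP forallP) => [h i j ji iA|dA i].
    by move: (h i) => /forallP/(_ j); rewrite ji iA.
  by apply/forallP => j; apply/implyP => ji; apply/implyP; exact: dA ji.
(* The common maximum is combinatorial: the largest [rk] of a member of a down-set with exactly [K]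
   elements. *)
pose Q := [pred p : {set I} * I | [&& ds p.1, #|p.1| == K & p.2 \in p.1]].
pose d := (\max_(p in Q) rk p.2)%N.
have ext (A : {set I}) : downset A -> (#|A| <= K)%N ->
    exists B : {set I}, [/\ A \subset B, downset B & #|B| = K].
  by move=> dA AK; apply: downset_extend => //; rewrite AK.
have bound (L : 'M[F]_('C(m, l))) C r : \rank L = K ->
    (forall v, C v -> lin_section iota L v) -> irred_chain C r -> (r <= d)%N.
  move=> rL CL ch; have rL' : \rank (map_mx iota L) = K by rewrite mxrank_map.
  have [A [cA dA [i iA ri]]] := section_chain_bound CL (fun v Cv => grass_neq0 (proj1 (CL v Cv))) ch.
  rewrite rL' in cA; have [B [AB dB cB]] := ext A dA cA.
  apply: leq_trans ri _; apply: (@leq_bigmax_cond _ Q (fun p => rk p.2) (B, i)).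
  by rewrite inE /= cB eqxx (subsetP AB _ iA) !andbT; apply/dsP.
(* The maximum is attained: the empty down-set extends to one with [K] elements, nonempty since
   [1 <= K]. *)
have [[A b] QAb dE] : exists2 p, p \in Q & d = rk p.2.
  have [|p Qp e] := @eq_bigmax_cond _ Q (fun p => rk p.2); last by exists p.
  have d0 : downset (set0 : {set I}) by move=> i j _; rewrite inE.
  have [|B [_ dB cB]] := ext set0 d0; first by rewrite cards0.
  have [b bB] : exists b, b \in B by apply/set0Pn; rewrite -card_gt0 cB.
  apply/card_gt0P; exists (B, b); rewrite inE /= cB eqxx bB !andbT; exact/dsP.
move: QAb; rewrite inE => /and3P[/dsP dA /eqP cA bA].
have rA : \rank (coord_space F A) = K by rewrite rank_coord_space.
have compA : has_component_dim iota (coord_space F A) d.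
  by apply: (schubert_var_component (ltnW hlm) dA bA) => // C r; exact: bound.
have ub (L : 'M[F]_('C(m, l))) r : \rank L = K -> has_component_dim iota L r -> (r <= d)%N.
  by move=> rL [C [CL _ _] [ch _]]; apply: bound rL CL ch.
exists d; split; split.
- by exists (coord_space F A).
- by move=> r [L rL]; exact: ub.
- by exists (coord_space F A); split=> //; exact: coord_space_spanned.
- by move=> r [L [rL _]]; exact: ub.
Qed.
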